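(* Let $K$ be a connected p.c.f. set, i.e. the connected attractor of a contractive p.c.f. IFS $\{S_j\}_{j=1}^N$ ($N\ge2$) on a complete metric space $(M,\rho)$, and suppose $K$ possesses a regular harmonic structure $(H,\mathbf s)$, $\mathbf s\in(0,1)^N$. Let $s_*=\min_js_j$, let $R$ be the associated resistance metric on $K$, and let $\tilde\theta_a$ be the metric on $K$ induced by the $AI_\infty$-graph $(X(\mathbf s),E^{(\infty)})$. Then there is a constant $C\ge1$ such that $$C^{-1}R(\xi,\eta)^{-a/\log s_*}\le\tilde\theta_a(\xi,\eta)\le C\,R(\xi,\eta)^{-a/\log s_*},\qquad\forall\ \xi,\eta\in K.$$
   Context: IFS: a contractive IFS on $(M,\rho)$ is a family of maps $S_j:M\to M$, $1\le j\le N$, with Lipschitz constants $<1$; its attractor $K$ is the unique nonempty compact set with $K=\bigcup_jS_j(K)$. Let $\Sigma=\{1,\dots,N\}$, $\Sigma^*=\bigcup_{n\ge0}\Sigma^n$ the finite words (empty word $\vartheta$), $S_x=S_{i_1}\circ\cdots\circ S_{i_n}$ for $x=i_1\cdots i_n$. P.c.f.: let $\Sigma^\infty$ be the set of infinite words over $\Sigma$, $\varpi:\Sigma^\infty\to K$, $\{\varpi(i_1i_2\cdots)\}=\bigcap_kS_{i_1\cdots i_k}(K)$, and $\sigma$ the left shift. Let $\mathcal C=\varpi^{-1}\big(\bigcup_{i\ne j}(S_i(K)\cap S_j(K))\big)$, $\mathcal P=\bigcup_{n\ge1}\sigma^n(\mathcal C)$. The IFS (or $K$) is p.c.f. (post critically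 finite) if $\mathcal P$ is a finite set; $V_0=\varpi(\mathcal P)$. Coding tree: with $s_x=s_{i_1}\cdots s_{i_m}$ for $x=i_1\cdots i_m$ ($s_\vartheta=1$), put $X_0=\{\vartheta\}$, $X_n=\{x=i_1\cdots i_m\in\Sigma^*:s_x\le s_*^n<s_{i_1}\cdots s_{i_{m-1}}\}$ ($n\ge1$), $X=X(\mathbf s)=\bigcup_nX_n$. $E_v$ joins $x\in X_n$ and $y\in X_{n+1}$ whenever $x$ is a prefix of $y$. $E^{(\infty)}=E_v\cup\bigcup_{n\ge1}\{(x,y)\in X_n\times X_n:x\ne y,\ S_x(K)\cap S_y(K)\ne\emptyset\}$. Gromov metric: with $d$ the graph distance of $(X(\mathbf s),E^{(\infty)})$, $|x|=d(\vartheta,x)$ and $(x|y)=\frac12(|x|+|y|-d(x,y))$, the graph is hyperbolic: there is $\delta\ge0$ with $(x|y)\ge\min\{(x|z),(z|y)\}-\delta$ for all $x,y,z$. Fix $a>0$ with $e^{\delta a}<\sqrt2$; $\theta_a(x,y)=\inf\{\sum_{i=1}^ne^{-a(x_{i-1}|x_i)}:n\ge1,\ x=x_0,\dots,x_n=y\in X\}$ for $x\ne y$, $\theta_a(x,x)=0$; $\partial X$ is the $\theta_a$-completion of $X$ minus $X$, with extended metric $\theta_a$. Each point of $\partial X$ is the limit of a ray $[x_i]_{i\ge0}$ with $x_i\in X_i$ and $x_i$ a prefix of $x_{i+1}$; the map $\kappa:\partial X\to K$ sending the limit of $[x_i]_i$ to the single point of $\bigcap_iS_{x_i}(K)$ is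 a well-defined bijection. The induced metric on $K$ is $\tilde\theta_a(\xi,\eta)=\theta_a(\kappa^{-1}(\xi),\kappa^{-1}(\eta))$. Harmonic structure: a (discrete) Laplacian $H=[H_{pq}]_{p,q\in V_0}$ on $V_0$ is a non-positive definite matrix on $V_0$ with $\sum_{q\in V_0}H_{pq}=0$ for all $p\in V_0$ and $H_{pq}\ge0$ for all distinct $p,q\in V_0$. Let $V_n=\bigcup_{x\in X_n}S_x(V_0)$ for $n\ge1$, $V_*=\bigcup_{n\ge0}V_n$, and $\ell(V)$ the real functions on $V$. Put $\mathcal E_0[u]=-\sum_{p,q\in V_0}u(p)H_{pq}u(q)$ for $u\in\ell(V_0)$ and $\mathcal E_n[u]=\sum_{x\in X_n}s_x^{-1}\mathcal E_0[u\circ S_x]$ for $u\in\ell(V_n)$, $n\ge1$. The pair $(H,\mathbf s)$, with $H$ a Laplacian on $V_0$, is a regular harmonic structure of $K$ if $\min\{\mathcal E_{n+1}[v]:v\in\ell(V_{n+1}),\ v=u\text{ on }V_n\}=\mathcal E_n[u]$ for all $n\ge0$, $u\in\ell(V_n)$. Then $\mathcal E[u]=\lim_n\mathcal E_n[u|_{V_n}]$ (an increasing limit) for $u\in\ell(V_* )$; any $u\in\ell(V_* )$ with $\mathcal E[u]<\infty$ extends continuously to $K$, and $\mathcal D=\{u\in C(K):\mathcal E[u]<\infty\}$, with $C(K)$ the continuous functions on $K$. The resistance metric is $R(\xi,\eta)=\big(\inf\{\mathcal E[u]:u(\xi)=1,\ u(\eta)=0\}\big)^{-1}$ for $\xi\ne\eta$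 in $K$ (infimum over $u\in\mathcal D$), and $R(\xi,\xi)=0$.
   Formalization: Two standard assumptions of Kigami's theory are added, as the claim fails without them: each S_j is injective on K, and the kernel of the Laplacian H on V_0 consists only of the constants. *)

(* Defs.v *)
From HB Require Import structures.
From mathcomp Require Import all_boot all_order all_algebra.
From mathcomp Require Import all_classical all_reals all_analysis.

Set Implicit Arguments.
Unset Strict Implicit.
Unset Printing Implicit Defensive.

Import Order.TTheory GRing.Theory Num.Theory.
Import numFieldNormedType.Exports.

Local Open Scope classical_set_scope.
Local Open Scope ring_scope.

Definition is_complete (T : uniformType) : Prop :=
  forall F : set_system T, ProperFilter F -> cauchy F ->
    exists l : T, F --> l.

Definition is_min (R : realType) (A : set R) (m : R) : Prop :=
  A m /\ lbound A m.

HB.instance Definition _ (T : choiceType) := isPointed.Build (seq T) [::].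

(* Metric completion of a subset X of T for a distance theta : T -> T -> R:
   the equivalence classes of theta-Cauchy sequences of points of X. *)
Section completion.
Context (R : realType) (T : pointedType) (X : set T) (theta : T -> T -> R).

Definition cauchy_seqs : set (nat -> T) :=
  [set u | (forall n, X (u n)) /\
    forall e : R, 0 < e ->
      exists k, forall m n, (k <= m)%N -> (k <= n)%N -> theta (u m) (u n) < e].

Definition cauchy_class (u : nat -> T) : set (nat -> T) :=
  [set v | cauchy_seqs v /\ theta (u n) (v n) @[n --> \oo] --> (0 : R)].

Definition completion : set (set (nat -> T)) := cauchy_class @` cauchy_seqs.

Definition embed (x : T) : set (nat -> T) := cauchy_class (fun=> x).

(* [get c] is a representative of the class c; the limit does not depend on
   the choice of representatives. *)
Definition completion_dist (c d : set (nat -> T)) : R :=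
  limn (fun n => theta (get c n) (get d n)).

Definition boundary : set (set (nat -> T)) := completion `\` (embed @` X).

Definition converges_to (x : nat -> T) (c : set (nat -> T)) : Prop :=
  completion_dist (embed (x i)) c @[i --> \oo] --> (0 : R).

End completion.

Section IFS.
Context (R : realType) (N : nat) (M : metricType R).
Context (S : 'I_N -> M -> M) (K : set M).

Definition contractive : Prop :=
  forall j, exists2 c : R, 0 <= c < 1 &
    forall p q, mdist (S j p) (S j q) <= c * mdist p q.

Definition attractor : Prop :=
  [/\ K !=set0, compact K & K = \bigcup_j (S j @` K)].

(* S_x = S_{i_1} o ... o S_{i_n} for the word x = [:: i_1; ...; i_n] *)
Definition word_map (x : seq 'I_N) : M -> M :=
  foldr (fun i f => S i \o f) id x.

Definition cell (x : seq 'I_N) : set M := word_map x @` K.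

(* The graph of the coding map from infinite words to K. *)
Definition codes (w : nat -> 'I_N) (p : M) : Prop :=
  \bigcap_k cell (mkseq w k) = [set p].

Definition shift (n : nat) (w : nat -> 'I_N) : nat -> 'I_N :=
  fun k => w (n + k)%N.

Definition critical_set : set (nat -> 'I_N) :=
  [set w | exists i j p,
     [/\ i != j, (S i @` K) p, (S j @` K) p & codes w p]].

Definition post_critical_set : set (nat -> 'I_N) :=
  \bigcup_(n in [set n | (1 <= n)%N]) (shift n @` critical_set).

Definition pcf : Prop := finite_set post_critical_set.

Definition V0 : set M := [set p | exists2 w, post_critical_set w & codes w p].

Context (s : 'I_N -> R).

Definition weight (x : seq 'I_N) : R := \prod_(i <- x) s i.

(* The minimum of the s_j; the default value 1 plays no role when N > 0 and
   all s_j < 1. *)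
Definition s_min : R := \big[Num.min/1]_(j < N) s j.

Definition level (n : nat) : set (seq 'I_N) :=
  if n is 0 then [set [::]]
  else [set x | exists y i,
          [/\ x = rcons y i, weight x <= s_min ^+ n & s_min ^+ n < weight y]].

Definition vertices : set (seq 'I_N) := \bigcup_n level n.

Definition vedge (x y : seq 'I_N) : Prop :=
  exists2 n, level n x /\ level n.+1 y & prefix x y.

Definition hedge (x y : seq 'I_N) : Prop :=
  exists2 n, [/\ (1 <= n)%N, level n x & level n y] &
    x != y /\ cell x `&` cell y !=set0.

(* The symmetric edge relation of the graph (X(s), E^(oo)). *)
Definition edge (x y : seq 'I_N) : Prop :=
  [\/ vedge x y, vedge y x | hedge x y].

Definition graph_dist (x y : seq 'I_N) : R :=
  inf [set n%:R | n in [set n : nat | exists c : nat -> seq 'I_N,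
    [/\ c 0%N = x, c n = y & forall i, (i < n)%N -> edge (c i) (c i.+1)]]].

Definition gromov_prod (x y : seq 'I_N) : R :=
  (graph_dist [::] x + graph_dist [::] y - graph_dist x y) / 2.

Definition gromov_hyperbolic (delta : R) : Prop :=
  forall x y z, vertices x -> vertices y -> vertices z ->
    Num.min (gromov_prod x z) (gromov_prod z y) - delta <= gromov_prod x y.

Definition theta (a : R) (x y : seq 'I_N) : R :=
  if x == y then 0 else
  inf [set t | exists (n : nat) (c : nat -> seq 'I_N),
    [/\ (1 <= n)%N, c 0%N = x, c n = y,
        forall i, (i <= n)%N -> vertices (c i) &
        t = \sum_(i < n) expR (- a * gromov_prod (c i) (c i.+1))]].

Definition ray (x : nat -> seq 'I_N) : Prop :=
  forall i, level i (x i) /\ prefix (x i) (x i.+1).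

(* The graph of the bijection kappa from the boundary of X to K. *)
Definition kappa (a : R) (z : set (nat -> seq 'I_N)) (xi : M) : Prop :=
  boundary vertices (theta a) z /\
  exists x, [/\ ray x, converges_to vertices (theta a) x z &
                \bigcap_i cell (x i) = [set xi]].

Definition kappa_inv (a : R) (xi : M) : set (nat -> seq 'I_N) :=
  get [set z | kappa a z xi].

Definition theta_K (a : R) (xi eta : M) : R :=
  completion_dist (theta a) (kappa_inv a xi) (kappa_inv a eta).

(* A matrix on V0 is given by the values on V0 x V0 of a function on M x M,
   and an element of l(V_n) by the values on V_n of a function on M. *)
Context (H : M -> M -> R).

Definition laplacian : Prop :=
  [/\ forall p q, V0 p -> V0 q -> H p q = H q p,
      forall u : M -> R,
        \sum_(p \in V0) \sum_(q \in V0) (u p * H p q * u q) <= 0,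
      forall p, V0 p -> \sum_(q \in V0) H p q = 0 &
      forall p q, V0 p -> V0 q -> p != q -> 0 <= H p q].

(* The constants are the only functions on V0 in the kernel of H. Without this
   (for instance if H = 0) the infimum defining the resistance vanishes. *)
Definition irreducible : Prop :=
  forall u : M -> R,
    (forall p, V0 p -> \sum_(q \in V0) (H p q * u q) = 0) ->
    forall p q, V0 p -> V0 q -> u p = u q.

(* For n = 0 this is V0 itself, as level 0 only contains the empty word; the
   same holds for energy_n 0, which is the quadratic form energy0. *)
Definition Vn (n : nat) : set M := \bigcup_(x in level n) (word_map x @` V0).

Definition energy0 (u : M -> R) : R :=
  - \sum_(p \in V0) \sum_(q \in V0) (u p * H p q * u q).

Definition energy_n (n : nat) (u : M -> R) : R :=
  \sum_(x \in level n) ((weight x)^-1 * energy0 (u \o word_map x)).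

Definition regular_harmonic : Prop :=
  laplacian /\
  forall n (u : M -> R),
    is_min [set energy_n n.+1 v | v in [set v | forall p, Vn n p -> v p = u p]]
           (energy_n n u).

Definition energy (u : M -> R) : \bar R := limn (fun n => (energy_n n u)%:E).

Definition energy_domain : set (M -> R) :=
  [set u | {within K, continuous u} /\ (energy u < +oo)%E].

Definition resistance (xi eta : M) : R :=
  if xi == eta then 0 else
  (fine (ereal_inf [set energy u |
     u in [set u | [/\ energy_domain u, u xi = 1 & u eta = 0]]]))^-1.

End IFS.

(* Main.v *)
(** Both metrics are compared with the Gromov product (x_i|y_i) of rays x, y
    whose cells shrink to xi and eta.  Since e^(delta a) < sqrt 2, Frink's chain
    lemma shows that theta_a(x_i, y_i) lies between e^(-a(x_i|y_i)) / 2 and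
    e^(-a(x_i|y_i)), so it suffices that R(xi, eta) is comparable to
    s_*^(x_i|y_i), uniformly for large i.

    Upper bound: irreducibility and the connectedness of the cells give
    |u(p) - u(q)| <= C s_*^(n/2) E[u]^(1/2) for p, q in a common cell of level
    n.  Along a geodesic from x_i to y_i the levels drop by at most one per step
    from either end, so the sum of these bounds is a geometric series of order
    s_*^((x_i|y_i)/2).

    Lower bound: if n is the first level at which the cells of xi and eta are
    disjoint, then (x_i|y_i) >= n - 2.  The harmonic extension of the indicator
    of the cell of xi on V_n separates xi from eta with energy O(s_*^(-n)),
    because in a p.c.f. set each cell has boundedly many neighbours. *)
Require Import Defs.
From mathcomp Require Import all_boot all_order all_algebra.
From mathcomp Require Import all_classical all_reals all_analysis.
From mathcomp Require Import zify ring lra.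
Import Order.TTheory GRing.Theory Num.Theory.
Import numFieldNormedType.Exports.

Set Implicit Arguments.
Unset Strict Implicit.
Unset Printing Implicit Defensive.

Local Open Scope classical_set_scope.
Local Open Scope ring_scope.

(** * Words and levels *)

(** The exponent is dictated by the two comparisons: if g is the Gromov product, raising [s_min ^ g]
    to the power -a / ln [s_min] gives e^(-a g). The constants stay independent of the level for two
    reasons: passing to the next level appends boundedly many letters, and boundedly many cells of
    one level share a point.

    The discrete energies see only the points of the sets [Vn], whereas the resistance is an infimum
    over continuous functions on [K]. The oscillation bound and the separating function are
    therefore first obtained at boundary points of cells and then carried to [K] along rays of
    shrinking cells.

    Injectivity of the maps [S j] on [K] allows common prefixes to be cancelled. Distinct cells of
    one level then meet only in images of [V0], so the energy sees every contact between cells. *)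

Lemma expr_eventually_lt (R : realType) (q e : R) :
  0 <= q < 1 -> 0 < e -> exists n, q ^+ n < e.
Proof.
move=> /andP[q0 q1] e0; have /cvg_expr : `|q| < 1 by rewrite ger0_norm.
move/cvgrPdist_lt => /(_ _ e0) [n _ /(_ n (leqnn n))] /=.
by rewrite sub0r normrN normrX ger0_norm// => ?; exists n.
Qed.

Lemma prefix_comparable (T : eqType) (x y z : seq T) :
  prefix x z -> prefix y z -> (size x <= size y)%N -> prefix x y.
Proof.
rewrite !prefixE => /eqP xz /eqP yz xy; apply/eqP.
by rewrite -yz take_takel.
Qed.

Lemma prefix_rcons_eq (T : eqType) (x y : seq T) i :
  prefix x (rcons y i) -> x = rcons y i \/ prefix x y.
Proof.
move=> h; have := size_prefix h; rewrite size_rcons leq_eqVlt => /orP[/eqP e|].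
  by left; move: h; rewrite prefixE e -(size_rcons y i) take_size => /eqP.
move=> l; right; apply: prefix_comparable h (prefix_rcons _ _) _.
by rewrite ltnS in l.
Qed.

Lemma prefix_mkseq (T : eqType) (w : nat -> T) m n :
  (m <= n)%N -> prefix (mkseq w m) (mkseq w n).
Proof.
by move=> mn; rewrite prefixE size_mkseq /mkseq -map_take take_iota (minn_idPl mn).
Qed.

Lemma mkseqD (T : Type) (w : nat -> T) m n :
  mkseq w (m + n) = mkseq w m ++ mkseq (fun k => w (m + k)%N) n.
Proof.
rewrite /mkseq iotaD map_cat add0n; congr (_ ++ _).
by rewrite -[X in iota X _]addn0 iotaDl -map_comp.
Qed.

Section Words.
Context (R : realType) (N : nat) (s : 'I_N -> R).
Context (hN : (2 <= N)%N) (hs : forall j, 0 < s j < 1).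

Let b := s_min s.

Lemma weight_cat x y : weight s (x ++ y) = weight s x * weight s y.
Proof. exact: big_cat. Qed.

Lemma weight_rcons x i : weight s (rcons x i) = weight s x * s i.
Proof. by rewrite -cats1 weight_cat {2}/weight big_seq1. Qed.

Lemma weight_nil : weight s [::] = 1.
Proof. exact: big_nil. Qed.

Lemma weight_gt0 x : 0 < weight s x.
Proof. by apply: prodr_gt0 => i _; case/andP: (hs i). Qed.

Lemma weight_le1 x : weight s x <= 1.
Proof.
by apply: prodr_ile1 => i _; case/andP: (hs i) => ? /ltW->; rewrite ltW.
Qed.

Lemma weight_prefix x y : prefix x y -> weight s y <= weight s x.
Proof.
move=> /prefixP[z ->]; rewrite weight_cat ler_piMr ?weight_le1//.
by rewrite ltW ?weight_gt0.
Qed.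

Lemma s_min_le j : b <= s j.
Proof. exact: bigmin_le. Qed.

Lemma s_min_gt0 : 0 < b.
Proof.
apply: (big_ind (fun x => 0 < x)) => // [x y x0 y0|i _].
  by rewrite lt_min x0.
by case/andP: (hs i).
Qed.

Lemma s_min_lt1 : b < 1.
Proof.
apply: le_lt_trans (s_min_le (Ordinal hN)) _.
by case/andP: (hs (Ordinal hN)).
Qed.

Lemma weight_size_bound : exists2 q, 0 < q < 1 &
  forall x, weight s x <= q ^+ size x.
Proof.
(* The default [2^-1] lies in (0, 1), so the maximum does as well. *)
exists (\big[Num.max/2^-1]_j s j).
  apply: (big_ind (fun x => 0 < x < 1)) => // [|x y /andP[x0 x1] /andP[y0 y1]].
    by lra.
  by rewrite lt_max x0 gt_max x1 y1.
elim=> [|i x IH]; first by rewrite weight_nil.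
rewrite /weight big_cons exprS ler_pM//.
- by case/andP: (hs i) => /ltW.
- by rewrite ltW ?weight_gt0.
- exact: le_bigmax.
Qed.

(** The word without its last letter weighs more than [b ^+ n], and one letter costs at most a
    factor [b]. The resulting half-open intervals are disjoint, so a word has at most one level. *)
Lemma level_weight n x : level s n x -> b ^+ n.+1 < weight s x <= b ^+ n.
Proof.
case: n => [|n] /=; first by move=> ->; rewrite weight_nil expr1 s_min_lt1 lexx.
move=> [y [i [-> -> h]]]; rewrite andbT exprSr weight_rcons.
apply: lt_le_trans (_ : weight s y * b <= _).
  by rewrite ltr_pM2r ?s_min_gt0.
by rewrite ler_pM2l ?weight_gt0 ?s_min_le.
Qed.

Lemma weight_lt_b_cat n x : level s n x -> (0 < n)%N ->
  forall y, prefix y x -> y != x -> b ^+ n < weight s y.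
Proof.
case: n => [//|n] [z [i [-> _ h]]] _ y /prefix_rcons_eq[->|yz]; first by rewrite eqxx.
by move=> _; apply: lt_le_trans h (weight_prefix yz).
Qed.

Lemma level_uniq m n x : level s m x -> level s n x -> m = n.
Proof.
move=> /level_weight/andP[m1 m2] /level_weight/andP[n1 n2].
have h k l : b ^+ k.+1 < weight s x -> weight s x <= b ^+ l -> (l <= k)%N.
  move=> p q; have := lt_le_trans p q.
  by rewrite ltr_iXn2l ?s_min_gt0 ?s_min_lt1.
by apply/eqP; rewrite eqn_leq (h _ _ n1 m2) (h _ _ m1 n2).
Qed.

(** A proper prefix of a word of level [m > 0] weighs more than [b ^+ m], too much for a level
    [n >= m]. In particular each level is an antichain for the prefix order. *)
Lemma level_prefix_eq m n x y : level s m x -> level s n y -> (m <= n)%N ->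
  prefix y x -> y = x.
Proof.
move=> mx ny mn yx; case: (posnP m) => [m0|m0].
  by move: mx yx; rewrite m0 /= => ->; rewrite prefixs0 => /eqP.
apply/eqP; apply: contraT => /(weight_lt_b_cat mx m0 yx).
case/andP: (level_weight ny) => _ ny' h.
have := lt_le_trans h ny'; rewrite ltr_iXn2l ?s_min_gt0 ?s_min_lt1//; lia.
Qed.

(** The ancestor is the shortest prefix of weight at most [b ^+ n]; letters are removed from the end
    until it is reached. *)
Lemma level_ancestor n y : weight s y <= b ^+ n ->
  exists2 x, level s n x & prefix x y.
Proof.
case: n => [|n]; first by exists [::] => //; exact: prefix0s.
elim/last_ind: y => [|y i IH] h.
  suff: weight s [::] < 1 by rewrite weight_nil ltxx.
  by apply: le_lt_trans h _; rewrite exprn_ilt1 ?s_min_lt1 ?ltW ?s_min_gt0.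
have [/IH[x xn xy]|h'] := leP (weight s y) (b ^+ n.+1).
  exists x => //; move/prefixP: xy => [z ->].
  by rewrite rcons_cat prefix_prefix.
by exists (rcons y i); [exists y, i|exact: prefix_refl].
Qed.

Lemma level_ancestor_le m n y : level s n y -> (m <= n)%N ->
  exists2 x, level s m x & prefix x y.
Proof.
move=> /level_weight/andP[_ h] mn; apply: level_ancestor; apply: le_trans h _.
by rewrite ler_wiXn2l// ltW// ?s_min_gt0 ?s_min_lt1.
Qed.

Lemma level_prefix_le m n x y z : level s m x -> level s n y -> (m <= n)%N ->
  prefix x z -> prefix y z -> prefix x y.
Proof.
move=> mx ny mn xz yz; have [|] := leqP (size x) (size y).
  exact: prefix_comparable xz yz.
move=> /ltnW/(prefix_comparable yz xz) yx.
by rewrite (level_prefix_eq mx ny)// prefix_refl.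
Qed.

Lemma level_code n (w : nat -> 'I_N) : exists k, level s n (mkseq w k).
Proof.
have [q q01 hq] := weight_size_bound.
have bn : 0 < b ^+ n by rewrite exprn_gt0 ?s_min_gt0.
have /expr_eventually_lt/(_ bn)[k hk] : 0 <= q < 1 by case/andP: q01 => /ltW->.
have : weight s (mkseq w k) <= b ^+ n.
  by apply: le_trans (hq _) _; rewrite size_mkseq ltW.
move=> /level_ancestor[x xn]; rewrite prefixE /mkseq -map_take take_iota => /eqP xE.
by eexists; rewrite -xE in xn; exact: xn.
Qed.

(** All appended letters but the last have total weight above [b], which bounds their number
    uniformly in [n]. This makes the constant of [children_connect] independent of the level. *)
Lemma children_size : exists L, forall n x z,
  level s n x -> level s n.+1 (x ++ z) -> (size z <= L)%N.
Proof.
have [q q01 hq] := weight_size_bound.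
have /expr_eventually_lt/(_ s_min_gt0)[k hk] : 0 <= q < 1 by case/andP: q01 => /ltW->.
exists k.+1 => n x z xn; case/lastP: z => [//|z i] hz.
have /(weight_lt_b_cat hz) : prefix (x ++ z) (x ++ rcons z i).
  by rewrite -rcons_cat prefix_rcons.
move=> /(_ isT) h; have {h} : b ^+ n.+1 < weight s (x ++ z).
  apply: h; rewrite -rcons_cat; apply/eqP => /(congr1 size).
  rewrite size_rcons; lia.
rewrite weight_cat exprS => h; rewrite size_rcons ltnS leqNgt; apply/negP => kz.
suff : b * b ^+ n < b * b ^+ n by rewrite ltxx.
apply: lt_le_trans h _; rewrite mulrC.
apply: ler_pM; rewrite ?(ltW (weight_gt0 _))//.
  apply: le_trans (hq z) _; apply: le_trans (ltW hk).
  by case/andP: q01 => /ltW q0 /ltW q1; rewrite ler_wiXn2l// ltnW.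
by case/andP: (level_weight xn).
Qed.

Lemma size_le_finite k : finite_set [set x : seq 'I_N | (size x <= k)%N].
Proof.
apply: (@sub_finite_set _ _ (@bseqval k 'I_N @` [set: {bseq k of 'I_N}])).
  by move=> x xk; exists (Bseq xk).
exact/finite_image/finite_finset.
Qed.

Lemma level_size_bound n : exists k, forall x, level s n x -> (size x <= k)%N.
Proof.
have [L hL] := children_size; exists (n * L)%N; elim: n => [x /= -> //|n IH x nx].
have [y yn /prefixP[z xE]] := level_ancestor_le nx (leqnSn n).
rewrite xE size_cat mulSn addnC leq_add ?IH//.
by apply: (hL n y) => //; rewrite -xE.
Qed.

Lemma level_finite n : finite_set (level s n).
Proof. by have [k hk] := level_size_bound n; exact: sub_finite_set (size_le_finite k). Qed.

Lemma weight_ge_expr x : b ^+ size x <= weight s x.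
Proof.
elim: x => [|i x IH]; first by rewrite weight_nil.
rewrite /weight big_cons exprS ler_pM ?s_min_le ?exprn_ge0// ltW ?s_min_gt0//.
Qed.

Lemma level_size_ge n x : level s n x -> (n <= size x)%N.
Proof.
move=> /level_weight/andP[_ /(le_trans (weight_ge_expr x))].
by rewrite ler_iXn2l ?s_min_gt0 ?s_min_lt1.
Qed.

End Words.

(** * Cells and boundary points *)

(* The union of the sets reachable from [F i] is relatively clopen in [A]. *)
Lemma connected_cover_connect (X : topologicalType) (T : finType)
    (A : set X) (F : T -> set X) :
  connected A -> (forall i, closed (F i)) -> A = \bigcup_i F i ->
  forall i j, F i !=set0 -> F j !=set0 ->
    connect (fun i j => (i != j) && `[< F i `&` F j !=set0 >]) i j.
Proof.
move=> cA cF AE i j [p Fp] [q Fq]; set e := (fun _ _ => _).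
pose B := \bigcup_(k in [set k | connect e i k]) F k.
pose C := \bigcup_(k in [set k | ~~ connect e i k]) F k.
have cB : closed B by apply: closed_bigcup => // *; exact: finite_finset.
have cC : closed C by apply: closed_bigcup => // *; exact: finite_finset.
have BC : B = A `&` ~` C.
  rewrite AE; apply/seteqP; split=> x.
    move=> [k /= ik Fk]; split; first by exists k.
    move=> [l /= il Fl]; move/negP: il; apply; apply: connect_trans ik _.
    have [->//|kl] := eqVneq k l; apply: connect1; rewrite /e kl/=.
    by apply/asboolP; exists x.
  move=> [[k _ Fk] nC]; exists k => //=; apply: contrapT => /negP ik.
  by apply: nC; exists k.
have : B = A.
  apply: cA; first by exists p, i => //=; exact: connect0.
    by exists (~` C) => //; exact: closed_openC.
  exists B => //; rewrite setIC; apply/esym/setIidl.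
  by rewrite BC; exact: subIsetl.
move=> BA; have : A q by rewrite AE; exists j.
rewrite -BA BC => -[_ nC]; apply: contrapT => /negP ij.
by apply: nC; exists j.
Qed.

(** A path can be shortened to one without repetitions, hence with at most [#|T|] edges. *)
Lemma connect_dist (R : realDomainType) (T : finType) (e : rel T) (f : T -> R) c :
  0 <= c -> (forall i j, e i j -> `|f i - f j| <= c) ->
  forall i j, connect e i j -> `|f i - f j| <= #|T|%:R * c.
Proof.
move=> c0 ec i j /connectP[p' /shortenP[p pth up _] -> {j}].
have : (size p <= #|T|)%N.
  by rewrite -(card_uniqP _)?max_card//; case/andP: up.
rewrite -(ler_nat R) => /(ler_wpM2r c0); apply: le_trans => {up p'}.
elim: p i pth => [|k p IH] i /=; first by rewrite subrr normr0 mul0r.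
move=> /andP[/ec ik /IH kp]; rewrite -(subrKA (f k)) -natr1 mulrDl mul1r [leRHS]addrC.
exact: le_trans (ler_normD _ _) (lerD ik kp).
Qed.

Section Cells.
Context (R : realType) (N : nat) (M : metricType R).
Context (S : 'I_N -> M -> M) (K : set M).
Context (hN : (2 <= N)%N) (hS : contractive S) (hK : attractor S K).
Context (hinj : forall j, set_inj K (S j)) (hconn : connected K).
Context (hpcf : pcf S K).

Lemma attractor_S j p : K p -> K (S j p).
Proof. by case: hK => _ _ KE Kp; rewrite KE; exists j => //; exists p. Qed.

Lemma attractor_split p : K p -> exists j q, K q /\ p = S j q.
Proof.
by case: hK => _ _ KE; rewrite {1}KE => -[j _ [q Kq <-]]; exists j, q.
Qed.

Lemma word_map_cat x y p :
  word_map S (x ++ y) p = word_map S x (word_map S y p).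
Proof. by elim: x => //= i x ->. Qed.

Lemma word_map_K x p : K p -> K (word_map S x p).
Proof. by move=> Kp; elim: x => //= i x; exact: attractor_S. Qed.

Lemma cell_K x : cell S K x `<=` K.
Proof. by move=> _ [p Kp <-]; exact: word_map_K. Qed.

Lemma cell_nil : cell S K [::] = K.
Proof. by rewrite /cell/= image_id. Qed.

Lemma cell_cat x y : cell S K (x ++ y) = word_map S x @` cell S K y.
Proof.
by rewrite /cell image_comp; apply: eq_imagel => p _; rewrite word_map_cat.
Qed.

Lemma cell_prefix x y : prefix x y -> cell S K y `<=` cell S K x.
Proof.
move=> /prefixP[z ->]; rewrite cell_cat => _ [p zp <-].
by exists p => //; exact: cell_K zp.
Qed.

Lemma cell_nonempty x : cell S K x !=set0.
Proof. by case: hK => [[p Kp] _ _]; exists (word_map S x p), p. Qed.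

Lemma word_map_inj x : set_inj K (word_map S x).
Proof.
elim: x => [|i x IH] p q; rewrite !inE => Kp Kq //= /hinj.
by rewrite !inE => /(_ (word_map_K _ Kp) (word_map_K _ Kq))/IH; rewrite !inE; exact.
Qed.

Lemma contractive_continuous j : continuous (S j).
Proof.
move=> p; have [c /andP[c0 c1] Sc] := hS j.
apply/metricType_numDomainType.cvgrPdist_lt => e e0.
have := nbhsx_ballx p e e0; rewrite ballEmdist.
apply: filterS => q /=; apply: le_lt_trans.
by apply: le_trans (Sc _ _) _; rewrite ler_piMl ?mdist_ge0// ltW.
Qed.

Lemma word_map_continuous x : continuous (word_map S x).
Proof.
elim: x => [|i x IH] p; first exact: cvg_id.
exact: (continuous_comp (IH p) (@contractive_continuous i _)).
Qed.

Lemma cell_compact x : compact (cell S K x).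
Proof.
case: hK => _ cK _; apply: continuous_compact cK.
by apply: continuous_subspaceT; exact: word_map_continuous.
Qed.

Lemma cell_closed x : closed (cell S K x).
Proof. by apply: compact_closed (@cell_compact x); exact: metric_hausdorff. Qed.

Lemma cell_connected x : connected (cell S K x).
Proof.
apply: connected_continuous_connected hconn _.
by apply: continuous_subspaceT; exact: word_map_continuous.
Qed.

Lemma attractor_bounded : exists2 D, 0 < D &
  forall p q, K p -> K q -> mdist p q <= D.
Proof.
case: hK => K0 cK _; have [z Kz] := K0.
have : {within K, continuous (fun p => mdist z p : R)}.
  apply: continuous_subspaceT => p; apply/cvgrPdist_lt => e e0.
  have := nbhsx_ballx p e e0; rewrite ballEmdist.
  apply: filterS => q /=; apply: le_lt_trans.
  rewrite ler_norml; have := metric_triangle q z p; have := metric_triangle z p q.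
  have := metric_triangle z q p; rewrite (metric_sym q p).
  by move=> *; apply/andP; split; lra.
move=> /(compact_EVT_max K0 cK)[c _ hc]; exists (2 * mdist z c + 1).
  by have := mdist_ge0 z c; lra.
move=> p q Kp Kq; have := metric_triangle p z q.
by have := hc p; have := hc q; rewrite !inE (metric_sym p z) => /(_ Kq) + /(_ Kp); lra.
Qed.

Lemma cell_diam : exists2 q, 0 < q < 1 & exists2 D, 0 < D &
  forall x p p', cell S K x p -> cell S K x p' -> mdist p p' <= D * q ^+ size x.
Proof.
have /choice[c hc] j : exists c, 0 <= c < 1 /\
    forall p q, mdist (S j p) (S j q) <= c * mdist p q.
  by have [c c1 c2] := hS j; exists c.
have [D D0 hD] := attractor_bounded.
exists (\big[Num.max/2^-1]_j c j).
  rewrite (lt_le_trans _ (bigmax_ge_id _ _ _ _))//=.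
  apply: (big_ind (fun x => x < 1)) => // [|x y x1 y1|j _]; first by lra.
    by rewrite gt_max x1 y1.
  by have [/andP[]] := hc j.
exists D => // x _ _ [p Kp <-] [p' Kp' <-].
elim: x => [|i x IH] /=; first by rewrite expr0 mulr1 hD.
have [/andP[c0 c1] Sc] := hc i; apply: le_trans (Sc _ _) _.
rewrite exprS mulrCA ler_pM ?mdist_ge0//.
exact: le_bigmax.
Qed.

Lemma codes_mkseq w p : codes S K w p -> forall k, cell S K (mkseq w k) p.
Proof. by move=> wp k; have : [set p] p by []; rewrite -wp; exact. Qed.

(** The diameters of the cells tend to 0 geometrically, so a point lying in all of them is the only
    one. *)
Lemma cell_codes w p : (forall k, cell S K (mkseq w k) p) -> codes S K w p.
Proof.
move=> h; apply/seteqP; split=> [p' h'|_ -> k _]; last exact: h.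
have [q /andP[q0 q1] [D D0 hD]] := cell_diam.
apply/mdist_positivity/eqP; rewrite eq_le mdist_ge0 andbT.
apply/ler_addgt0Pl => e e0; rewrite addr0.
have [||n hn] := @expr_eventually_lt _ q (e / D).
- by rewrite ltW.
- by rewrite divr_gt0.
have := hD (mkseq w n) _ _ (h' n I) (h n); rewrite size_mkseq => /le_trans; apply.
by rewrite -ler_pdivlMl// mulrC ltW.
Qed.

Lemma codes_exists p : K p -> exists w, codes S K w p.
Proof.
move=> Kp.
have /choice[f hf] q : exists f : 'I_N * M, K q -> K f.2 /\ q = S f.1 f.2.
  have [Kq|nKq] := pselect (K q); last by exists (Ordinal hN, q).
  by have [j [r [Kr ->]]] := attractor_split Kq; exists (j, r).
pose r k := iter k (fun q => (f q).2) p.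
have Kr k : K (r k) by elim: k => //= k /hf[].
exists (fun k => (f (r k)).1); apply: cell_codes => k; exists (r k) => //.
elim: k => // k IH; rewrite -addn1 mkseqD word_map_cat/= addn0.
by have [_ e] := hf _ (Kr k); rewrite addn1 -[r k.+1]/((f (r k)).2) -e.
Qed.

Lemma codes_K w p : codes S K w p -> K p.
Proof. by move=> /codes_mkseq/(_ 0%N); rewrite cell_nil. Qed.

(** Injectivity makes the preimage of [p] under the first [k] maps the same for all longer prefixes,
    so one [q] lies in all the shifted cells. *)
Lemma codes_shift k w p : codes S K w p ->
  exists2 q, codes S K (Defs.shift k w) q & p = word_map S (mkseq w k) q.
Proof.
move=> wp; have [q Kq pE] := codes_mkseq wp k; exists q => //.
apply: cell_codes => m; have := codes_mkseq wp (k + m).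
rewrite mkseqD cell_cat -pE => -[q' q'm] /word_map_inj; rewrite !inE => <- //.
exact: cell_K q'm.
Qed.

Definition cons_code (x : seq 'I_N) (w : nat -> 'I_N) : nat -> 'I_N :=
  fun k => if (k < size x)%N then nth (w 0%N) x k else w (k - size x)%N.

Lemma mkseq_cons_code x w k :
  mkseq (cons_code x w) (size x + k) = x ++ mkseq w k.
Proof.
rewrite mkseqD; congr (_ ++ _).
  rewrite -[RHS](mkseq_nth (w 0%N)); apply/eq_in_map => i.
  by rewrite mem_iota /= add0n /cons_code => ->.
by apply: eq_mkseq => i; rewrite /cons_code ltnNge leq_addr/= addKn.
Qed.

Lemma shift_cons_code x w : Defs.shift (size x) (cons_code x w) = w.
Proof. by apply/funext => k; rewrite /Defs.shift /cons_code ltnNge leq_addr/= addKn. Qed.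

Lemma codes_cons x w p : codes S K w p -> codes S K (cons_code x w) (word_map S x p).
Proof.
move=> wp; apply: cell_codes => k; have [/subnKC <-|kx] := leqP (size x) k.
  by rewrite mkseq_cons_code cell_cat; exists p => //; exact: codes_mkseq.
apply: (@cell_prefix _ x); last by exists p => //; exact: codes_K wp.
rewrite -[X in prefix _ X]cats0 -[_ ++ _](mkseq_cons_code x w 0) addn0.
exact: prefix_mkseq (ltnW kx).
Qed.

Lemma V0_K : V0 S K `<=` K.
Proof. by move=> p [w _ /codes_K]. Qed.

Lemma V0_finite : finite_set (V0 S K).
Proof.
case: hK => -[z Kz] _ _.
have /choice[f hf] w : exists p, forall q, codes S K w q -> q = p.
  have [[p wp]|nex] := pselect (exists p, codes S K w p); last first.
    by exists z => q wq; exfalso; apply: nex; exists q.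
  by exists p => q; rewrite /codes wp => /(congr1 (@^~ q)) e; have : [set q] q by []; rewrite -e.
apply: sub_finite_set (finite_image f hpcf) => p [w Pw wp].
by exists w => //; apply/esym/hf.
Qed.

Lemma post_critical_shift n w : post_critical_set S K w ->
  post_critical_set S K (Defs.shift n w).
Proof.
move=> [m /= m1 [c Cc <-]]; exists (m + n)%N; first by rewrite /= ltn_addr.
by exists c => //; apply/funext => k; rewrite /Defs.shift addnA.
Qed.

(** The common image lies in two first-level cells, so prefixing a code of [p] by [i :: x] gives a
    critical word; removing this nonempty prefix gives a post critical one. *)
Lemma critical_cons i j x y p q : i != j -> K p -> K q ->
  word_map S (i :: x) p = word_map S (j :: y) q -> V0 S K p.
Proof.
move=> ij Kp Kq e; have [w wp] := codes_exists Kp; exists w => //.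
exists (size (i :: x)) => //; exists (cons_code (i :: x) w); last exact: shift_cons_code.
exists i, j, (word_map S (i :: x) p); split=> //.
- by exists (word_map S x p) => //; exact: word_map_K.
- by rewrite e; exists (word_map S y q) => //; exact: word_map_K.
- exact: codes_cons.
Qed.

(** Common letters are cancelled by injectivity until the words branch; there [critical_cons] shows
    that the preimage of [p] is a boundary point. *)
Lemma cell_meet x y p : ~~ prefix x y -> ~~ prefix y x ->
  cell S K x p -> cell S K y p -> (word_map S x @` V0 S K) p.
Proof.
elim: x y p => [|i x IH] [|j y] p//=.
have [<-|ij] := eqVneq i j.
  rewrite /= => xy yx [q Kq <-] [q' Kq'] /= /hinj; rewrite !inE.
  move=> /(_ (word_map_K _ Kq') (word_map_K _ Kq)) e'.
  have [||v Vv vE] := IH y (word_map S x q) xy yx.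
  - by exists q.
  - by exists q'.
  by exists v => //=; rewrite vE.
move=> _ _ [q Kq <-] [q' Kq' /esym e]; exists q => //.
exact: critical_cons ij Kq Kq' e.
Qed.

(** A connected [K] covered by at least two first-level cells must have two distinct ones that meet,
    and they meet in a boundary point. *)
Lemma V0_nonempty : V0 S K !=set0.
Proof.
have KE : K = \bigcup_i cell S K [:: i].
  by case: hK => _ _ {1}->; apply: eq_bigcupr => i _; rewrite /cell.
pose i0 : 'I_N := Ordinal (ltnW hN); pose i1 : 'I_N := Ordinal hN.
have : connect (fun i j => (i != j) &&
    `[< cell S K [:: i] `&` cell S K [:: j] !=set0 >]) i0 i1.
  apply: connected_cover_connect hconn _ KE _ _ _ _ => [i||].
  - exact: cell_closed.
  - exact: cell_nonempty.
  - exact: cell_nonempty.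
case/connectP => -[|j p] //= /andP[/andP[ij /asboolP[q [qi qj]]] _] _.
have := cell_meet _ _ qi qj; rewrite !prefix_cons !prefix0s !andbT (negbTE ij).
rewrite (negbTE (_ : j != i0)); last by rewrite eq_sym.
by move=> /(_ isT isT)[v Vv _]; exists v.
Qed.

(** A critical word is one letter followed by its own shift, which is post critical. *)
Lemma critical_finite : finite_set (critical_set S K).
Proof.
apply: (@sub_finite_set _ _ (\bigcup_(i in [set: 'I_N])
    ((fun w => cons_code [:: i] w) @` post_critical_set S K))).
  move=> w Cw; exists (w 0%N) => //; exists (Defs.shift 1 w).
    by exists 1%N => //; exists w.
  by apply/funext => -[|k]//=; rewrite /cons_code /Defs.shift /= subn1.
by apply: bigcup_finite; [exact: finite_finset | move=> i _; exact: finite_image].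
Qed.

(* After removal of their longest common prefix, the codes of [p] that start
   with the given words become distinct critical words. *)
Lemma card_cells_at_point : exists B : nat, forall (ls : seq (seq 'I_N)) p,
  uniq ls -> {in ls &, forall x y, prefix x y -> x = y} ->
  {in ls, forall x, cell S K x p} -> (size ls <= B)%N.
Proof.
have /finite_set_leP[n /pcard_leP[f]] := critical_finite.
(* There are [n] critical words; the successor also covers the case where no two of the chosen codes
   differ, and the list has at most one word. *)
exists n.+1 => ls p uls incomp lsp.
have /choice[g hg] x : exists w, x \in ls -> codes S K w p /\ mkseq w (size x) = x.
  have [xl|_] := boolP (x \in ls); last by exists (fun=> Ordinal hN).
  have [q Kq <-] := lsp x xl; have [w wq] := codes_exists Kq.
  exists (cons_code x w) => _; split; first exact: codes_cons.
  by have := mkseq_cons_code x w 0; rewrite addn0 cats0.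
have ginj x y : x \in ls -> y \in ls -> g x = g y -> x = y.
  move=> xl yl e; have [_ gx] := hg x xl; have [_ gy] := hg y yl.
  have [xy|/ltnW yx] := leqP (size x) (size y).
    by apply: incomp => //; rewrite -gx -gy e; exact: prefix_mkseq.
  by apply/esym; apply: incomp => //; rewrite -gx -gy e; exact: prefix_mkseq.
have [exk|nex] := pselect (exists k, `[< exists x y,
    [/\ x \in ls, y \in ls & g x k != g y k] >]); last first.
  suff : (size ls <= 1)%N by lia.
  case: ls uls lsp incomp hg ginj nex => [//|x [//|y ls]] /= /andP[xy _] _ _ _ ginj nex.
  exfalso; move: xy; rewrite inE negb_or => /andP[/eqP xy _]; apply: xy.
  apply: ginj; rewrite ?inE ?eqxx ?orbT//; apply/funext => k.
  apply: contrapT => /eqP e; apply: nex; exists k; apply/asboolP; exists x, y.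
  by rewrite !inE !eqxx !orbT.
case: (ex_minnP exk) => k /asboolP[x1 [x2 [l1 l2 x12]]] kmin.
have agree x y l : x \in ls -> y \in ls -> (l < k)%N -> g x l = g y l.
  move=> xl yl lk; apply: contrapT => /eqP e.
  suff /kmin : `[< exists x y, [/\ x \in ls, y \in ls & g x l != g y l] >] by lia.
  by apply/asboolP; exists x, y.
have mkE x y : x \in ls -> y \in ls -> mkseq (g x) k = mkseq (g y) k.
  by move=> xl yl; apply/eq_in_map => l; rewrite mem_iota => /andP[_ lk]; exact: agree.
(* After the common [k] letters all codes point, by injectivity, to the same [q], and [g x1], [g x2]
   place [q] in two different first-level cells. Hence every shifted code is critical, not only
   those of [x1] and [x2]. *)
have crit x : x \in ls -> critical_set S K (Defs.shift k (g x)).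
  move=> xl; have [cx _] := hg x xl; have [c1 _] := hg x1 l1; have [c2 _] := hg x2 l2.
  have [q cq pq] := codes_shift k cx; have [q1 cq1 pq1] := codes_shift k c1.
  have [q2 cq2 pq2] := codes_shift k c2.
  have e1 : q1 = q.
    apply: (@word_map_inj (mkseq (g x) k)); rewrite ?inE.
    - exact: codes_K cq1.
    - exact: codes_K cq.
    by rewrite -pq pq1 (mkE x x1).
  have e2 : q2 = q.
    apply: (@word_map_inj (mkseq (g x) k)); rewrite ?inE.
    - exact: codes_K cq2.
    - exact: codes_K cq.
    by rewrite -pq pq2 (mkE x x2).
  exists (g x1 k), (g x2 k), q; split=> //; [rewrite -e1|rewrite -e2].
    have [q' /codes_K Kq' ->] := codes_shift 1 cq1; exists q' => //=.
    by rewrite /Defs.shift addn0.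
  have [q' /codes_K Kq' ->] := codes_shift 1 cq2; exists q' => //=.
  by rewrite /Defs.shift addn0.
have : uniq (map (fun x => f (Defs.shift k (g x))) ls).
  rewrite map_inj_in_uniq// => x y xl yl /(@inj _ _ _ f).
  rewrite !inE => /(_ (crit x xl) (crit y yl)) e; apply: ginj => //.
  apply/funext => l; have [lk|kl] := ltnP l k; first exact: agree.
  by have := congr1 (@^~ (l - k)%N) e; rewrite /Defs.shift subnKC.
move=> /(@uniq_leq_size _ _ (iota 0 n)); rewrite size_map size_iota => h.
apply: leqW; apply: h => _ /mapP[x xl ->]; rewrite mem_iota/= add0n.
exact: (@funS _ _ _ _ f _ (crit x xl)).
Qed.

(** * Cells along the levels of the coding tree *)

Section Levels.
Context (s : 'I_N -> R) (hs : forall j, 0 < s j < 1).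

Lemma cell_level_below m n x p : level s m x -> (m <= n)%N -> cell S K x p ->
  exists2 y, level s n y /\ prefix x y & cell S K y p.
Proof.
move=> mx mn [q Kq <-]; have [w wq] := codes_exists Kq.
have [k ky] := level_code hN hs n (cons_code x w); exists (mkseq (cons_code x w) k).
  split=> //; apply: (level_prefix_le hN hs mx ky mn (z := mkseq (cons_code x w) (size x + k))).
    by rewrite mkseq_cons_code prefix_prefix.
  by apply: prefix_mkseq; rewrite leq_addl.
exact/codes_mkseq/codes_cons.
Qed.

(** Tails of post critical words are post critical, so a boundary point of a cell remains a boundary
    point of some descendant at every deeper level. *)
Lemma V0_level_below m n x p : level s m x -> (m <= n)%N ->
  (word_map S x @` V0 S K) p ->
  exists2 y, level s n y /\ prefix x y & (word_map S y @` V0 S K) p.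
Proof.
move=> mx mn [q [w Pw wq] <-].
have [k ky] := level_code hN hs n (cons_code x w); exists (mkseq (cons_code x w) k).
  split=> //; apply: (level_prefix_le hN hs mx ky mn (z := mkseq (cons_code x w) (size x + k))).
    by rewrite mkseq_cons_code prefix_prefix.
  by apply: prefix_mkseq; rewrite leq_addl.
have [v cv ->] := codes_shift k (codes_cons x wq); exists v => //.
have xk : (size x <= k)%N.
  have := level_prefix_le hN hs mx ky mn (z := mkseq (cons_code x w) (size x + k)).
  rewrite {1}mkseq_cons_code prefix_prefix prefix_mkseq ?leq_addl// => /(_ isT isT)/size_prefix.
  by rewrite size_mkseq.
exists (Defs.shift k (cons_code x w)) => //.
rewrite -(subnKC xk) (_ : Defs.shift _ _ = Defs.shift (k - size x) w).
  exact: post_critical_shift.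
by apply/funext => l; rewrite /Defs.shift /cons_code -addnA ltnNge leq_addr /= addKn.
Qed.

Lemma level_incomparable n x y : level s n x -> level s n y -> prefix x y -> x = y.
Proof. by move=> nx ny xy; apply: (level_prefix_eq hN hs ny nx (leqnn n)). Qed.

Lemma cell_level_meet n x y p : level s n x -> level s n y -> x != y ->
  cell S K x p -> cell S K y p -> (word_map S x @` V0 S K) p.
Proof.
move=> nx ny xy; apply: cell_meet; apply/negP => /level_incomparable.
  by move=> /(_ _ nx ny)/eqP; rewrite (negbTE xy).
by move=> /(_ _ ny nx)/eqP; rewrite eq_sym (negbTE xy).
Qed.

Lemma word_map_V0_cell x : word_map S x @` V0 S K `<=` cell S K x.
Proof. by move=> _ [v Vv <-]; exists v => //; exact: V0_K. Qed.

Lemma Vn_cell n x p : level s n x -> cell S K x p -> Vn S K s n p ->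
  (word_map S x @` V0 S K) p.
Proof.
move=> nx xp [y ny yp]; have [->//|xy] := eqVneq x y.
exact: cell_level_meet nx ny xy xp (word_map_V0_cell yp).
Qed.

Lemma Vn_mono m n : (m <= n)%N -> Vn S K s m `<=` Vn S K s n.
Proof.
by move=> mn p [x mx /(V0_level_below mx mn)[y [ny _] yp]]; exists y.
Qed.

Lemma ray_exists p : K p -> exists x, ray s x /\ forall n, cell S K (x n) p.
Proof.
move=> /codes_exists[w wp].
have /choice[k hk] n := level_code hN hs n w.
exists (fun n => mkseq w (k n)); split=> [n|n]; last exact: codes_mkseq.
split=> //; apply: (level_prefix_le hN hs (hk n) (hk n.+1) (leqnSn n)
  (z := mkseq w (k n + k n.+1))).
  by rewrite prefix_mkseq ?leq_addr.
by rewrite prefix_mkseq ?leq_addl.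
Qed.

Lemma ray_mono x m n : ray s x -> (m <= n)%N -> prefix (x m) (x n).
Proof.
move=> rx /subnK <-; elim: (n - m)%N => [|k IH]; first exact: prefix_refl.
have [_] := rx (k + m)%N; move: IH => /prefixP[z ->] /prefixP[z' ->].
by rewrite -catA prefix_prefix.
Qed.

Lemma level_cell_small e : 0 < e -> exists n, forall m x p q,
  (n <= m)%N -> level s m x -> cell S K x p -> cell S K x q -> mdist p q < e.
Proof.
move=> e0; have [q /andP[q0 q1] [D D0 hD]] := cell_diam.
have [||n hn] := @expr_eventually_lt _ q (e / D).
- by rewrite ltW.
- by rewrite divr_gt0.
exists n => m x p p' nm mx xp xp'; apply: le_lt_trans (hD _ _ _ xp xp') _.
rewrite mulrC -ltr_pdivlMr//; apply: le_lt_trans hn.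
apply: ler_wiXn2l; rewrite ?ltW//.
exact: leq_trans nm (level_size_ge hN hs mx).
Qed.

Lemma ray_cells_point x p : ray s x -> (forall n, cell S K (x n) p) ->
  \bigcap_i cell S K (x i) = [set p].
Proof.
move=> rx xp; apply/seteqP; split=> [q xq|_ ->//].
apply/mdist_positivity/eqP; rewrite eq_le mdist_ge0 andbT.
apply/ler_addgt0Pl => e e0; rewrite addr0.
have [n hn] := level_cell_small e0; have [nx _] := rx n.
by apply/ltW/(hn n (x n)) => //; exact: xq.
Qed.

(** The children of [x] cover the connected set [cell x], so any two of them are joined by a chain
    of touching children. Its length is at most the number of words of length at most [L]. *)
Lemma children_connect : exists B, forall n x, level s n x ->
  forall (f : seq 'I_N -> R) c, 0 <= c ->
  (forall y y' p, level s n.+1 y -> level s n.+1 y' -> prefix x y -> prefix x y' ->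
     cell S K y p -> cell S K y' p -> `|f y - f y'| <= c) ->
  forall y y', level s n.+1 y -> level s n.+1 y' -> prefix x y -> prefix x y' ->
    `|f y - f y'| <= B * c.
Proof.
have [L hL] := children_size hN hs.
pose T : finType := {bseq L of 'I_N}; exists #|T|%:R => n x nx f c c0 hc.
move=> y y' + + /prefixP[z yE] /prefixP[z' yE']; rewrite {y}yE {y'}yE' => ny ny'.
(* The index type is the same for all [x]; words that do not lead to a child contribute the empty
   set. *)
pose F (t : T) := if `[< level s n.+1 (x ++ t) >] then cell S K (x ++ t) else set0.
have := @connected_cover_connect _ T (cell S K x) F (@cell_connected x) _ _
  (Bseq (hL _ _ _ nx ny)) (Bseq (hL _ _ _ nx ny')).
rewrite {3 4}/F /= !asboolT// => conn.
apply: (connect_dist (f := fun t : T => f (x ++ t)) c0 _ (conn _ _ _ _)).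
- move=> t t' /andP[_ /asboolP[p []]]; rewrite /F.
  do 2 case: asboolP => //; move=> h h' *.
  by apply: (hc _ _ p) => //; rewrite prefix_prefix.
- move=> t; rewrite /F; case: asboolP => _; [exact: cell_closed|exact: closed0].
- apply/seteqP; split=> p.
    move=> /(cell_level_below nx (leqnSn n))[y [yn /prefixP[t yE]] yp].
    rewrite yE in yn yp; exists (Bseq (hL _ _ _ nx yn)) => //.
    by rewrite /F /= asboolT.
  move=> [t _]; rewrite /F; case: asboolP => // _; apply: cell_prefix.
  exact: prefix_prefix.
- exact: cell_nonempty.
- exact: cell_nonempty.
Qed.

End Levels.
End Cells.

(** * Discrete energies *)

Lemma fsbig_enum (T : choiceType) (V : set T) : finite_set V ->
  exists k (v : 'I_k -> T), [/\ injective v, V = range v &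
    forall (G : nmodType) (F : T -> G), \sum_(p \in V) F p = \sum_(i < k) F (v i)].
Proof.
move=> /finite_seqP[l0 V0E]; pose l := undup l0; have uV : uniq l := undup_uniq l0.
have VE : V = [set` l] by rewrite V0E; apply/seteqP; split=> p /=; rewrite mem_undup.
exists (size l), (tnth (in_tuple l)); split.
- by move=> i j; apply: (tuple_uniqP (in_tuple l)).
- rewrite {1}VE; apply/seteqP; split=> [p /= /(tnthP (in_tuple l))[i ->]|_ [i _ <-]] /=.
    by exists i.
  exact: mem_tnth.
- by move=> G F; rewrite {1}VE -fsbig_seq// big_tnth.
Qed.

Section Laplacian.
Context (R : realType) (N : nat) (M : metricType R).
Context (S : 'I_N -> M -> M) (K : set M) (H : M -> M -> R).
Context (hfin : finite_set (V0 S K)) (hL : laplacian S K H).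

(** When the squares are expanded, the terms in [u p ^+ 2] vanish with the row sums, and only the
    cross terms, counted twice, remain. *)
Lemma energy0E u : exists k (v : 'I_k -> M), [/\ injective v, V0 S K = range v &
  energy0 S K H u = 2^-1 * \sum_(i < k) \sum_(j < k) H (v i) (v j) * (u (v i) - u (v j)) ^+ 2].
Proof.
have [k [v [vinj VE sumE]]] := fsbig_enum hfin; exists k, v; split=> //.
have [sym _ row0 _] := hL.
have Vv i : V0 S K (v i) by rewrite VE; exists i.
have rv i : \sum_(j < k) H (v i) (v j) = 0 by rewrite -sumE row0.
rewrite /energy0 sumE; under eq_bigr do rewrite sumE.
pose X := \sum_(i < k) \sum_(j < k) u (v i) * H (v i) (v j) * u (v j).
have -> : \sum_(i < k) \sum_(j < k) H (v i) (v j) * (u (v i) - u (v j)) ^+ 2 =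
  \sum_(i < k) u (v i) ^+ 2 * (\sum_(j < k) H (v i) (v j)) +
  \sum_(j < k) u (v j) ^+ 2 * (\sum_(i < k) H (v j) (v i)) - 2 * X.
  transitivity (\sum_(i < k) \sum_(j < k) (u (v i) ^+ 2 * H (v i) (v j) +
    u (v j) ^+ 2 * H (v j) (v i) - 2 * (u (v i) * H (v i) (v j) * u (v j)))).
    by apply: eq_bigr => i _; apply: eq_bigr => j _; rewrite (sym (v j) (v i))//; ring.
  under eq_bigr do rewrite sumrB big_split/=.
  rewrite sumrB big_split/= [X in _ + X - _]exchange_big/=.
  congr (_ + _ - _).
  - by apply: eq_bigr => i _; rewrite mulr_sumr.
  - by apply: eq_bigr => i _; rewrite mulr_sumr.
  - by rewrite mulr_sumr; apply: eq_bigr => i _; rewrite mulr_sumr.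
have z : \sum_(i < k) u (v i) ^+ 2 * (\sum_(j < k) H (v i) (v j)) = 0.
  by rewrite big1// => i _; rewrite rv mulr0.
by rewrite !z -/X; lra.
Qed.

Lemma energy0_eq u u' : (forall p, V0 S K p -> u p = u' p) ->
  energy0 S K H u = energy0 S K H u'.
Proof.
move=> e; rewrite /energy0; congr (- _).
by apply: eq_fsbigr => p; rewrite inE => Vp; apply: eq_fsbigr => q; rewrite inE => Vq; rewrite !e.
Qed.

Lemma energy0_edge p q u : V0 S K p -> V0 S K q ->
  H p q * (u p - u q) ^+ 2 <= 2 * energy0 S K H u.
Proof.
have [k [v [vinj VE ->]]] := energy0E u; have [_ _ _ pos] := hL.
have t0 i j : 0 <= H (v i) (v j) * (u (v i) - u (v j)) ^+ 2.
  have [->|ij] := eqVneq i j; first by rewrite subrr expr0n mulr0.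
  rewrite mulr_ge0 ?sqr_ge0// pos ?VE//; try by eexists.
  by rewrite (inj_eq vinj).
rewrite {1 2}VE => -[i _ <-] [j _ <-]; rewrite mulVKf ?pnatr_eq0//.
rewrite (bigD1 i)//= (bigD1 j)//= -addrA lerDl addr_ge0 ?sumr_ge0// => l _.
by rewrite sumr_ge0.
Qed.

Lemma energy0_ge0 u : 0 <= energy0 S K H u.
Proof. by have [_ nonpos _ _] := hL; rewrite /energy0 oppr_ge0. Qed.

Lemma energy0_const u c : (forall p, V0 S K p -> u p = c) -> energy0 S K H u = 0.
Proof.
have [k [v [_ VE ->]]] := energy0E u; move=> uc; rewrite big1 ?mulr0// => i _.
have Vv l : V0 S K (v l) by rewrite VE; exists l.
by rewrite big1// => j _; rewrite !uc// subrr expr0n mulr0.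
Qed.

Lemma energy0_bounded : exists2 E, 0 <= E & forall u : M -> R,
  (forall p, V0 S K p -> 0 <= u p <= 1) -> energy0 S K H u <= E.
Proof.
have [k [v [vinj VE sumE]]] := fsbig_enum hfin.
exists (\sum_(i < k) \sum_(j < k) `|H (v i) (v j)|).
  by apply: sumr_ge0 => i _; apply: sumr_ge0.
move=> u u01; apply: le_trans (ler_norm _) _.
rewrite /energy0 normrN sumE; under eq_bigr do rewrite sumE.
apply: le_trans (ler_norm_sum _ _ _) _; apply: ler_sum => i _.
apply: le_trans (ler_norm_sum _ _ _) _; apply: ler_sum => j _.
have [/andP[i0 i1] /andP[j0 j1]] : 0 <= u (v i) <= 1 /\ 0 <= u (v j) <= 1.
  by split; apply: u01; rewrite VE; eexists.
rewrite !normrM (ger0_norm i0) (ger0_norm j0).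
rewrite -[leRHS]mulr1 ler_pM ?mulr_ge0//.
by rewrite -[leRHS]mul1r ler_wpM2r.
Qed.

(* Irreducibility makes the graph on V0 with the edges [0 < H p q] connected:
   the indicator of a connected component lies in the kernel of [H]. *)
Lemma energy0_osc : irreducible S K H -> exists2 D, 0 <= D & forall (u : M -> R) p q,
  V0 S K p -> V0 S K q -> `|u p - u q| <= D * Num.sqrt (energy0 S K H u).
Proof.
move=> irr; have [k [v [vinj VE sumE]]] := fsbig_enum hfin.
have [sym _ row0 pos] := hL.
have Vv i : V0 S K (v i) by rewrite VE; exists i.
pose e := [rel i j : 'I_k | 0 < H (v i) (v j)].
have econn i0 i : connect e i0 i.
  pose u p : R := if `[< exists2 i, v i = p & connect e i0 i >] then 1 else 0.
  have uE j : u (v j) = (connect e i0 j)%:R.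
    rewrite /u; case: asboolP => [[l /vinj -> ->]//|h].
    by have [c|//] := boolP (connect e i0 j); exfalso; apply: h; exists j.
  have : u (v i) = u (v i0).
    apply: irr => // p; rewrite VE => -[l _ <-]; rewrite -VE sumE.
    have H0 j j' : connect e i0 j -> ~~ connect e i0 j' -> H (v j) (v j') = 0.
      move=> ij nij'; apply/eqP; rewrite eq_le pos//; last first.
        by rewrite (inj_eq vinj); apply: contraNneq nij' => <-.
      rewrite andbT leNgt; apply: contraNN nij' => h.
      by apply: connect_trans ij _; exact: connect1.
    under eq_bigr do rewrite uE.
    have [il|nil] := boolP (connect e i0 l).
      rewrite -[RHS](row0 (v l))// sumE; apply: eq_bigr => j _.
      by have [c|nc] := boolP (connect e i0 j); rewrite ?mulr1// mulr0 H0.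
    rewrite big1// => j _.
    by have [c|nc] := boolP (connect e i0 j); rewrite ?mulr0// sym// H0// mul0r.
  rewrite !uE connect0 => /eqP; case: connect => //; by rewrite eq_sym oner_eq0.
(* Along an edge [H * (du) ^+ 2] is at most twice the energy, so [B] bounds the jump [du] by the
   square root of [2 * B] times the energy; a path has at most [k] edges. *)
pose B := \big[Num.max/0]_(t : 'I_k * 'I_k) (H (v t.1) (v t.2))^-1.
have B0 : 0 <= B by exact: bigmax_ge_id.
exists (k%:R * Num.sqrt (2 * B)); first by rewrite mulr_ge0// sqrtr_ge0.
move=> u p q; rewrite {1 2}VE => -[i _ <-] [j _ <-].
have := @connect_dist _ _ e (u \o v) (Num.sqrt (2 * B) * Num.sqrt (energy0 S K H u))
  _ _ i j (econn i j).
rewrite card_ord mulrA; apply.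
  by rewrite mulr_ge0 ?sqrtr_ge0.
move=> {}i {}j /= hij; rewrite -sqrtrM ?mulr_ge0// -sqrtr_sqr ler_wsqrtr//.
have := energy0_edge u (Vv i) (Vv j); rewrite -ler_pdivlMl// => /le_trans; apply.
rewrite mulrCA mulrA ler_wpM2r ?energy0_ge0// ler_wpM2l//.
exact: (le_bigmax _ _ (i, j)).
Qed.

Context (s : 'I_N -> R) (hs : forall j, 0 < s j < 1) (hN : (2 <= N)%N).

Lemma energy_n_enum n : exists ls, [/\ uniq ls, level s n = [set` ls] &
  forall u, energy_n S K s H n u =
    \sum_(x <- ls) (weight s x)^-1 * energy0 S K H (u \o word_map S x)].
Proof.
have /finite_seqP[l0 l0E] := level_finite hN hs n.
pose l := undup l0; have ul : uniq l := undup_uniq l0.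
have lE : level s n = [set` l].
  by rewrite l0E; apply/seteqP; split=> p /=; rewrite mem_undup.
by exists l; split=> // u; rewrite /energy_n lE -fsbig_seq.
Qed.

Lemma energy_n_eq n u u' : (forall p, Vn S K s n p -> u p = u' p) ->
  energy_n S K s H n u = energy_n S K s H n u'.
Proof.
move=> e; apply: eq_fsbigr => x; rewrite inE => nx; congr (_ * _).
by apply: energy0_eq => p Vp /=; apply: e; exists x => //; exists p.
Qed.

Lemma weighted_energy0_ge0 u x : 0 <= (weight s x)^-1 * energy0 S K H u.
Proof. by rewrite mulr_ge0 ?energy0_ge0// invr_ge0 ltW ?weight_gt0. Qed.

Lemma energy_n_ge0 n u : 0 <= energy_n S K s H n u.
Proof.
have [ls [_ _ ->]] := energy_n_enum n; rewrite sumr_ge0// => x _.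
exact: weighted_energy0_ge0.
Qed.

(** One term is at most the whole sum, and the weight of the cell is at most [s_min s ^+ n]. Taking
    square roots gives the decay rate of oscillations in [energy_n_osc]. *)
Lemma energy_n_cell n x u : level s n x ->
  energy0 S K H (u \o word_map S x) <= s_min s ^+ n * energy_n S K s H n u.
Proof.
move=> nx; have [ls [uls lsE ->]] := energy_n_enum n.
have xl : x \in ls by have := nx; rewrite lsE.
rewrite (bigD1_seq x)//=; set T := \sum_(_ <- _ | _) _.
have T0 : 0 <= T by apply: sumr_ge0 => y _; exact: weighted_energy0_ge0.
have w0 := weight_gt0 hs x; have /andP[_ wb] := level_weight hN hs nx.
apply: le_trans (_ : weight s x * ((weight s x)^-1 * energy0 S K H (u \o word_map S x)) <= _).
  by rewrite mulrA divff ?mul1r// gt_eqF.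
by apply: ler_pM => //; rewrite ?weighted_energy0_ge0 ?lerDl ?(ltW w0).
Qed.

Lemma energy_n_osc : irreducible S K H -> exists2 D, 0 <= D & forall n x u p q,
  level s n x -> (word_map S x @` V0 S K) p -> (word_map S x @` V0 S K) q ->
  `|u p - u q| <= D * Num.sqrt (s_min s) ^+ n * Num.sqrt (energy_n S K s H n u).
Proof.
move=> /energy0_osc[D D0 hD]; exists D => // n x u _ _ nx [p Vp <-] [q Vq <-].
apply: le_trans (hD (u \o word_map S x) _ _ Vp Vq) _.
rewrite -mulrA ler_wpM2l// -[X in _ <= X * _]ger0_norm ?exprn_ge0 ?sqrtr_ge0//.
rewrite -sqrtr_sqr exprAC sqr_sqrtr; last by rewrite ltW ?s_min_gt0.
rewrite -sqrtrM ?exprn_ge0 ?(ltW (s_min_gt0 hs))//.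
by rewrite ler_wsqrtr// energy_n_cell.
Qed.

End Laplacian.

(** * Functions of finite energy *)

(** The limit is the supremum of the lower bounds [u n - e n], each of which lies below every upper
    bound [u m + e m]. *)
Lemma cauchy_rate_limit (R : realType) (u e : nat -> R) :
  (forall n, 0 <= e n) -> (forall n k, `|u n - u (n + k)%N| <= e n) ->
  exists l, forall n, `|u n - l| <= e n.
Proof.
move=> e0 he; pose A := [set x | exists n, x = u n - e n].
have ubA m : ubound A (u m + e m).
  move=> _ [n ->]; have := e0 n; have := e0 m.
  have [/subnKC nm|/ltnW/subnKC mn] := leqP n m.
    have := he n (m - n)%N; rewrite nm ler_norml; lra.
  have := he m (n - m)%N; rewrite mn ler_norml; lra.
have A0 : A !=set0 by exists (u 0%N - e 0%N), 0%N.
exists (sup A) => n; rewrite ler_norml.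
have h1 : sup A <= u n + e n by apply: ge_sup.
have h2 : u n - e n <= sup A by apply: ub_le_sup; [exists (u n + e n)|exists n].
by apply/andP; split; lra.
Qed.

Lemma eq_of_geometric_bound (R : realType) (x y c q : R) (n : nat) : 0 <= c -> 0 <= q < 1 ->
  (forall m, (n <= m)%N -> `|x - y| <= c * q ^+ m) -> x = y.
Proof.
move=> c0 q01 h; apply/eqP; rewrite -subr_eq0 -normr_le0.
apply/ler_addgt0Pl => e e0; rewrite addr0.
have c1 : 0 < c + 1 by lra.
have [k hk] := expr_eventually_lt q01 (divr_gt0 e0 c1).
apply: le_trans (h (n + k)%N (leq_addr _ _)) _; case/andP: q01 => q0 q1.
apply: le_trans (_ : (c + 1) * q ^+ k <= _); last first.
  by rewrite mulrC -ler_pdivlMr// ltW.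
apply: ler_pM => //; [exact: exprn_ge0|lra|].
by rewrite ler_wiXn2l ?leq_addl// ltW.
Qed.

Section Morrey.
Context (R : realType) (N : nat) (M : metricType R).
Context (S : 'I_N -> M -> M) (K : set M) (s : 'I_N -> R) (H : M -> M -> R).
Context (hN : (2 <= N)%N) (hS : contractive S) (hK : attractor S K).
Context (hinj : forall j, set_inj K (S j)) (hconn : connected K).
Context (hpcf : pcf S K) (hs : forall j, 0 < s j < 1).
Context (hirr : irreducible S K H) (hH : regular_harmonic S K s H).

Let hfin := V0_finite hK hpcf.
Let hL : laplacian S K H := proj1 hH.
Let r : R := Num.sqrt (s_min s).
Let En := energy_n S K s H.

Lemma root_s_min : 0 < r < 1.
Proof.
rewrite sqrtr_gt0 s_min_gt0//= -sqrtr1 ltr_sqrt//.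
exact: s_min_lt1 hN hs.
Qed.

Let r0 : 0 < r. Proof. by case/andP: root_s_min. Qed.
Let r1 : r < 1. Proof. by case/andP: root_s_min. Qed.
Let rn0 n : 0 <= r ^+ n. Proof. by rewrite exprn_ge0// ltW. Qed.

(** [u] itself is one of the extensions over which the harmonic structure minimizes. *)
Lemma energy_n_le m n u : (m <= n)%N -> En m u <= En n u.
Proof.
move=> /subnK <-; elim: (n - m)%N => [|k IH]; first by rewrite add0n.
apply: le_trans IH _; have [_ lb] := hH.2 (k + m)%N u.
by apply: lb; exists u.
Qed.

(** A real bound [E] on all discrete energies replaces finiteness of [energy], so that the estimate
    also applies to functions that are controlled only on the sets [Vn]. *)
Lemma osc_bound : exists2 D, 0 <= D & forall u E, (forall m, En m u <= E) ->
  forall n x p q, level s n x ->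
  (word_map S x @` V0 S K) p -> (word_map S x @` V0 S K) q ->
  `|u p - u q| <= D * r ^+ n * Num.sqrt E.
Proof.
have [D D0 hD] := energy_n_osc hfin hL hs hN hirr; exists D => // u E hE n x p q nx xp xq.
apply: le_trans (hD n x u p q nx xp xq) _.
by rewrite ler_wpM2l ?mulr_ge0// ler_wsqrtr.
Qed.

Context (v0 : M) (hv0 : V0 S K v0).
(** One reference boundary point per cell; the values of [u] at these points along a ray form the
    Cauchy sequence that defines the extension to [K]. *)
Let base x := word_map S x v0.

Lemma base_V0 x : (word_map S x @` V0 S K) (base x).
Proof. by exists v0. Qed.

Lemma base_cell x : cell S K x (base x).
Proof. exact: (word_map_V0_cell (base_V0 x)). Qed.

(** [base x] is a boundary point of some child [y'], and a bounded chain of touching children joins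
    [y'] to [y]. Each contact is a common boundary point, through which two base points are compared
    at cost [2 * D]. *)
Lemma base_step : exists2 C, 0 <= C & forall u E, (forall m, En m u <= E) ->
  forall n x y, level s n x -> level s n.+1 y -> prefix x y ->
  `|u (base x) - u (base y)| <= C * r ^+ n * Num.sqrt E.
Proof.
have [D D0 hD] := osc_bound.
have [B hB] := children_connect hN hS hK hconn hs.
exists (D + `|B| * (2 * D)); first by rewrite addr_ge0 ?mulr_ge0//; lra.
move=> u E hE n x y nx ny xy; set q := Num.sqrt E.
have q0 : 0 <= q by exact: sqrtr_ge0.
have step : D * r ^+ n.+1 * q <= D * r ^+ n * q.
  rewrite ler_wpM2r// ler_wpM2l// exprS ler_piMl ?rn0//; exact: ltW.
have [y' [ny' xy'] yx] := V0_level_below hN hS hK hinj hs nx (leqnSn n) (base_V0 x).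
rewrite -(subrKA (u (base y'))) !mulrDl; apply: le_trans (ler_normD _ _) _.
apply: lerD; first exact: le_trans (hD _ _ hE _ _ _ _ ny' yx (base_V0 y')) step.
have c0 : 0 <= 2 * D * r ^+ n * q by rewrite !mulr_ge0.
apply: le_trans (hB n x nx (u \o base) _ c0 _ y' y ny' ny xy' xy) _; last first.
  rewrite [leRHS](_ : _ = `|B| * (2 * D * r ^+ n * q)); last by ring.
  by rewrite ler_wpM2r ?ler_norm.
move=> {yx}z z' p nz nz' _ _ zp zp' /=.
have [->|zz'] := eqVneq z z'; first by rewrite subrr normr0.
have zp0 := cell_level_meet hN hS hK hinj hs nz nz' zz' zp zp'.
have zp0' : (word_map S z' @` V0 S K) p.
  by apply: (cell_level_meet hN hS hK hinj hs nz' nz _ zp' zp); rewrite eq_sym.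
rewrite -(subrKA (u p)); apply: le_trans (ler_normD _ _) _.
have := hD _ _ hE _ _ _ _ nz (base_V0 z) zp0.
have := hD _ _ hE _ _ _ _ nz' zp0' (base_V0 z').
rewrite -/q; lra.
Qed.

(* Geometric sum over the levels between [x] and [y]. *)
Lemma base_below : exists2 C, 0 <= C & forall u E, (forall m, En m u <= E) ->
  forall n k x y, level s n x -> level s (n + k) y -> prefix x y ->
  `|u (base x) - u (base y)| <= C * r ^+ n * Num.sqrt E.
Proof.
have [C0 C00 hC] := base_step.
have r1' : 0 < 1 - r by rewrite subr_gt0.
exists (C0 / (1 - r)); first by rewrite divr_ge0// ltW.
move=> u E hE n k; elim: k n => [|k IH] n x y nx ny xy.
  rewrite addn0 in ny.
  rewrite (level_prefix_eq hN hs ny nx (leqnn n) xy) subrr normr0.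
  by rewrite !mulr_ge0 ?sqrtr_ge0// invr_ge0 ltW.
have [|z nz zy] := level_ancestor_le hN hs (m := n.+1) ny; first by rewrite addnS ltnS leq_addr.
have xz := level_prefix_le hN hs nx nz (leqnSn n) xy zy.
rewrite -(subrKA (u (base z))); apply: le_trans (ler_normD _ _) _.
have h1 := hC _ _ hE _ _ _ nx nz xz.
have h2 : `|u (base z) - u (base y)| <= C0 / (1 - r) * r ^+ n.+1 * Num.sqrt E.
  by apply: IH => //; rewrite addSnnS.
apply: le_trans (lerD h1 h2) _; rewrite -mulrDl ler_wpM2r ?sqrtr_ge0//.
rewrite exprS mulrA -mulrDl ler_wpM2r// le_eqVlt; apply/orP; left; apply/eqP.
by field; rewrite gt_eqF.
Qed.

(** The cells of level [n] that miss [p] form a finite closed union; every point of [K] in its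
    complement shares a cell of level [n] with [p]. *)
Lemma continuous_of_cell_osc (u : M -> R) c : 0 <= c ->
  (forall n x p q, level s n x -> cell S K x p -> cell S K x q -> `|u p - u q| <= c * r ^+ n) ->
  {within K, continuous u}.
Proof.
move=> c0 hc; apply/subspace_continuousP => p Kp.
apply/cvgrPdist_lt => e e0; rewrite near_withinE.
have [||n hn] := @expr_eventually_lt _ r (e / (c + 1)).
- by rewrite ltW.
- by rewrite divr_gt0//; lra.
pose F := \bigcup_(x in [set x | level s n x /\ ~ cell S K x p]) cell S K x.
have cF : closed F.
  apply: closed_bigcup => [|x _]; last exact: cell_closed.
  by apply: sub_finite_set (level_finite hN hs n) => x [].
have : nbhs p (~` F).
  by apply: open_nbhs_nbhs; split; [exact: closed_openC | move=> [x []]].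
apply: filterS => q nFq Kq.
have [x [rx xq]] := ray_exists hN hS hK hs Kq; have [nx _] := rx n.
have xp : cell S K (x n) p by apply: contrapT => nxp; apply: nFq; exists (x n).
apply: le_lt_trans (hc n _ p q nx xp (xq n)) _.
apply: le_lt_trans (_ : (c + 1) * r ^+ n < e); first by rewrite ler_wpM2r//; lra.
by rewrite mulrC -ltr_pdivlMr//; lra.
Qed.

(* [u] matters only on the union of the Vn; [u' p] is the limit of [u (base x)]
   over the cells [x] shrinking to [p]. *)
Lemma finite_energy_extension : exists2 C, 0 <= C &
  forall u E, (forall m, En m u <= E) -> exists u' : M -> R,
  [/\ {within K, continuous u'}, forall n p, Vn S K s n p -> u' p = u p &
   forall n x p, level s n x -> cell S K x p ->
     `|u' p - u (base x)| <= C * r ^+ n * Num.sqrt E].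
Proof.
have [D D0 hD] := osc_bound; have [C C0 hC] := base_below.
exists (C + 2 * D); first by lra.
move=> u E hE; set q := Num.sqrt E; have q0 : 0 <= q by exact: sqrtr_ge0.
have /choice[u' hu'] p : exists l, K p -> exists2 x, (ray s x /\ forall n, cell S K (x n) p) &
    forall n, `|u (base (x n)) - l| <= C * r ^+ n * q.
  have [Kp|nKp] := pselect (K p); last by exists 0.
  have [x [rx xp]] := ray_exists hN hS hK hs Kp.
  have [||l hl] := @cauchy_rate_limit _ (fun n => u (base (x n))) (fun n => C * r ^+ n * q).
  - by move=> n; rewrite !mulr_ge0.
  - move=> n k; apply: (hC u E hE n k); first by have [] := rx n.
      by have [] := rx (n + k)%N.
    exact: (ray_mono rx (leq_addr _ _)).
  by exists l => _; exists x.
have near n x p : level s n x -> cell S K x p ->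
    `|u' p - u (base x)| <= (C + 2 * D) * r ^+ n * q.
  move=> nx xp; have [y [ry yp] hy] := hu' p (cell_K hK xp).
  have [ny _] := ry n; have := hy n.
  have [<-|xy] := eqVneq (y n) x.
    rewrite distrC => /le_trans; apply; rewrite !mulrDl lerDl.
    by rewrite addr_ge0// !mulr_ge0.
  (* When the chosen ray of [p] does not pass through [x], the point [p] is a common boundary point
     of [x] and [y n]; the detour through [p] accounts for the extra [2 * D]. *)
  have h1 := cell_level_meet hN hS hK hinj hs ny nx xy (yp n) xp.
  have h2 : (word_map S x @` V0 S K) p.
    by apply: (cell_level_meet hN hS hK hinj hs nx ny _ xp (yp n)); rewrite eq_sym.
  have := hD _ _ hE _ _ _ _ ny (base_V0 _) h1.
  have := hD _ _ hE _ _ _ _ nx h2 (base_V0 _).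
  rewrite -/q !ler_norml !mulrDl; lra.
exists u'; split=> //.
- apply: (@continuous_of_cell_osc _ (2 * (C + 2 * D) * q)).
    by rewrite !mulr_ge0//; lra.
  move=> n x p p' nx xp xp'; have := near _ _ _ nx xp; have := near _ _ _ nx xp'.
  have -> : 2 * (C + 2 * D) * q * r ^+ n =
      (C + 2 * D) * r ^+ n * q + (C + 2 * D) * r ^+ n * q by ring.
  rewrite !ler_norml; lra.
- move=> n p np.
  have Kp : K p.
    by case: np => x _ /word_map_V0_cell; exact: cell_K.
  (* From level [n] on, [p] is a boundary point of every cell containing it; comparing [u' p] and
     [u p] with the base point costs [C + 2 * D] and [D]. *)
  apply: (@eq_of_geometric_bound _ _ _ ((C + 3 * D) * q) r n).
  + by rewrite mulr_ge0//; lra.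
  + by rewrite ltW.
  move=> m nm; have [x [rx xp]] := ray_exists hN hS hK hs Kp.
  have [mx _] := rx m; have := near _ _ _ mx (xp m).
  have mp := Vn_cell hN hS hK hinj hs mx (xp m) (Vn_mono hN hS hK hinj hs nm np).
  have := hD _ _ hE _ _ _ _ mx mp (base_V0 _).
  rewrite -/q.
  have -> : (C + 3 * D) * q * r ^+ m = (C + 2 * D) * r ^+ m * q + D * r ^+ m * q by ring.
  by rewrite !ler_norml; lra.
Qed.

(** By continuity [u] at a point of [K] is the limit of its values at base points of shrinking
    cells, and so is its extension [u']. They agree on [K], and [u] inherits the estimate of
    [u']. *)
Lemma morrey : exists2 C, 0 <= C & forall u E, {within K, continuous u} ->
  (forall m, En m u <= E) ->
  forall n x p q, level s n x -> cell S K x p -> cell S K x q ->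
  `|u p - u q| <= C * r ^+ n * Num.sqrt E.
Proof.
have [C C0 hC] := finite_energy_extension; exists (2 * C); first by lra.
move=> u E cu hE; have [u' [cu' _ hu']] := hC u E hE.
have uu' p : K p -> u p = u' p.
  move=> Kp; apply/eqP; rewrite -subr_eq0 -normr_le0.
  apply/ler_addgt0Pl => e e0; rewrite addr0.
  have e2 : 0 < e / 2 by lra.
  have /subspace_continuousP/(_ p Kp)/cvgrPdist_lt/(_ _ e2) := cu.
  rewrite near_withinE => /nbhs_ballP[d /= d0 hd].
  have [n1 hn1] := level_cell_small hN hS hK hs d0.
  have [||n2 hn2] := @expr_eventually_lt _ r (e / 2 / (C * Num.sqrt E + 1)).
  - by rewrite ltW.
  - by rewrite divr_gt0// ltr_wpDl// mulr_ge0 ?sqrtr_ge0.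
  have [x [rx xp]] := ray_exists hN hS hK hs Kp; have [nx _] := rx (n1 + n2)%N.
  have h1 : `|u p - u (base (x (n1 + n2)%N))| < e / 2.
    apply: hd; last exact: cell_K (base_cell _).
    rewrite ballEmdist /=; apply: hn1 nx (xp _) (base_cell _).
    exact: leq_addr.
  have h2 := hu' _ _ _ nx (xp _).
  have h3 : C * r ^+ (n1 + n2) * Num.sqrt E < e / 2.
    rewrite mulrAC; apply: le_lt_trans (_ : (C * Num.sqrt E + 1) * r ^+ n2 < _).
      apply: ler_pM; rewrite ?mulr_ge0 ?sqrtr_ge0// ?lerDl//.
      by rewrite ler_wiXn2l ?leq_addl// ltW.
    by rewrite mulrC -ltr_pdivlMr// ltr_wpDl// mulr_ge0 ?sqrtr_ge0.
  move: h1 h2 h3; rewrite !ltr_norml !ler_norml; lra.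
move=> n x p q nx xp xq; rewrite !uu'; try exact: cell_K xp; try exact: cell_K xq.
have := hu' _ _ _ nx xp; have := hu' _ _ _ nx xq; rewrite !ler_norml -!mulrA.
lra.
Qed.

(** * Harmonic extension and separating functions *)

Lemma energy_lim_ge n u : ((En n u)%:E <= energy S K s H u)%E.
Proof.
have nd : {homo (fun n => (En n u)%:E) : m n / (m <= n)%N >-> (m <= n)%E}.
  by move=> m k mk; rewrite lee_fin energy_n_le.
have -> : energy S K s H u = limn (fun n => (En n u)%:E) by [].
by rewrite (cvg_lim _ (ereal_nondecreasing_cvgn nd))//; apply: ereal_sup_ubound; exists n.
Qed.

Lemma energy_lim_le u E : (forall n, En n u <= E) -> (energy S K s H u <= E%:E)%E.
Proof.
move=> hE; apply: lime_le; last by apply: nearW => n; rewrite lee_fin.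
by apply: ereal_nondecreasing_is_cvgn => m k mk; rewrite lee_fin energy_n_le.
Qed.

(** The minimum is attained at each level, so minimizers can be chosen one level after another. Each
    keeps the earlier values and the same energy, and gluing them along the increasing sets [Vn]
    gives [w]. *)
Lemma harmonic_extension n u : exists w,
  (forall p, Vn S K s n p -> w p = u p) /\ forall m, En m w <= En n u.
Proof.
have /choice[ext hext] (t : nat * (M -> R)) : exists v,
    (forall p, Vn S K s t.1 p -> v p = t.2 p) /\ En t.1.+1 v = En t.1 t.2.
  by have [[v vu e] _] := hH.2 t.1 t.2; exists v; split=> // p tp; apply: vu.
pose f := fix f k := if k is k'.+1 then ext ((n + k')%N, f k') else u.
have fS k p : Vn S K s (n + k) p -> f k.+1 p = f k p.
  by move=> kp; apply: (hext ((n + k)%N, f k)).1.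
have fD k j p : Vn S K s (n + k) p -> f (k + j)%N p = f k p.
  move=> kp; elim: j => [|j IH]; first by rewrite addn0.
  rewrite addnS fS//; apply: (Vn_mono hN hS hK hinj hs) kp; lia.
have fE k : En (n + k) (f k) = En n u.
  elim: k => [|k <-]; first by rewrite addn0.
  by rewrite addnS; apply: (hext ((n + k)%N, f k)).2.
have /choice[w hw] p : exists t, forall k, Vn S K s (n + k) p -> t = f k p.
  have [[k kp]|nex] := pselect (exists k, Vn S K s (n + k) p); last first.
    by exists 0 => k kp; exfalso; apply: nex; exists k.
  exists (f k p) => j jp; have [/subnKC <-|/ltnW/subnKC <-] := leqP k j.
    by rewrite fD.
  by rewrite fD.
exists w; split=> [p np|m]; first by rewrite (hw p 0%N)// addn0.
have [nm|/ltnW mn] := leqP n m.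
  rewrite -(fE (m - n)%N) subnKC// (_ : En m w = En m (f (m - n)%N))//.
  by apply: energy_n_eq => p mp; apply: hw; rewrite subnKC.
apply: le_trans (energy_n_le w mn) _; rewrite (_ : En n w = En n u)//.
by apply: energy_n_eq => p np; rewrite (hw p 0%N)// addn0.
Qed.

Lemma energy_n_le_cellwise n u u' :
  (forall x, level s n x -> 
     energy0 S K H (u \o word_map S x) <= energy0 S K H (u' \o word_map S x)) ->
  En n u <= En n u'.
Proof.
move=> h; have [ls [_ lsE sumE]] := energy_n_enum S K H hs hN n.
rewrite /En !sumE !big_seq; apply: ler_sum => x xl.
have nx : level s n x by rewrite lsE.
by rewrite ler_wpM2l ?h// invr_ge0 ltW ?weight_gt0.
Qed.

(** For [m >= n] each cell of level [m] lies in one cell of level [n]. Inside [x] or [y] the new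
    function is constant and has no energy; elsewhere these two cells are met only in boundary
    points, where [w] already has the prescribed value. *)
Lemma replace_on_cells n x y w : level s n x -> level s n y ->
  cell S K x `&` cell S K y = set0 ->
  (forall p, (word_map S x @` V0 S K) p -> w p = 1) ->
  (forall p, (word_map S y @` V0 S K) p -> w p = 0) ->
  exists w' : M -> R, [/\ forall p, cell S K x p -> w' p = 1,
    forall p, cell S K y p -> w' p = 0 & forall m, (n <= m)%N -> En m w' <= En m w].
Proof.
move=> nx ny xy0 wx wy.
have xy p : cell S K x p -> cell S K y p -> False.
  by move=> xp yp; have : set0 p by rewrite -xy0.
pose w' p := if `[< cell S K x p >] then 1 else if `[< cell S K y p >] then 0 else w p.
exists w'.
have w1 p : cell S K x p -> w' p = 1.
  by move=> xp; rewrite /w' asboolT.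
have w0 p : cell S K y p -> w' p = 0.
  by move=> yp; rewrite /w' asboolF ?asboolT// => /xy; exact.
split=> // m nm; apply: energy_n_le_cellwise => z mz.
have [t nt tz] := level_ancestor_le hN hs mz nm.
have zt p : V0 S K p -> cell S K t (word_map S z p).
  by move=> Vp; apply: (cell_prefix hK tz); apply: word_map_V0_cell; exists p.
have [xt|xt] := eqVneq x t.
  rewrite (@energy0_const _ _ _ _ _ _ hfin hL _ 1) ?energy0_ge0// => p Vp /=.
  by apply: w1; rewrite xt; exact: zt.
have [yt|yt] := eqVneq y t.
  rewrite (@energy0_const _ _ _ _ _ _ hfin hL _ 0) ?energy0_ge0// => p Vp /=.
  by apply: w0; rewrite yt; exact: zt.
rewrite le_eqVlt; apply/orP; left; apply/eqP; apply: energy0_eq => p Vp /=.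
rewrite /w'; case: asboolP => [xp|_].
  rewrite wx//; exact: (cell_level_meet hN hS hK hinj hs nx nt xt xp (zt p Vp)).
case: asboolP => [yp|//].
by rewrite wy//; exact: (cell_level_meet hN hS hK hinj hs ny nt yt yp (zt p Vp)).
Qed.

(* Only the boundedly many cells of level [n] that meet [cell x] contribute. *)
Lemma cell_indicator_energy : exists2 A, 0 <= A & forall n x, level s n x ->
  En n (fun p => if `[< cell S K x p >] then 1 else 0) <= A * (s_min s ^+ n.+1)^-1.
Proof.
have [A0 A00 hA0] := energy0_bounded H hfin.
have [B hB] := card_cells_at_point hN hS hK hinj hpcf.
have [k [v [_ VE _]]] := fsbig_enum hfin.
(* The cell has [k] boundary points, each lying in at most [B] cells of the level, and [A0] bounds
   the unweighted energy of each such cell. *)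
exists ((k * B)%:R * A0); first by rewrite mulr_ge0.
move=> n x nx; set u := (fun p => _).
have [ls [uls lsE sumE]] := energy_n_enum S K H hs hN n.
have lsn z : z \in ls -> level s n z by rewrite lsE.
pose P (i : 'I_k) z := `[< cell S K z (word_map S x (v i)) >].
pose meets z := [exists i, P i z].
have b0 : 0 < s_min s ^+ n.+1 by rewrite exprn_gt0 ?s_min_gt0.
have term z : z \in ls -> (weight s z)^-1 * energy0 S K H (u \o word_map S z) <=
    (meets z)%:R * (A0 * (s_min s ^+ n.+1)^-1).
  move=> zl; have nz := lsn z zl; have /andP[wz _] := level_weight hN hs nz.
  case: (boolP (meets z)) => mz.
    rewrite mul1r mulrC ler_pM ?energy0_ge0 ?invr_ge0 ?(ltW (weight_gt0 _ _))//.
      by apply: hA0 => p _ /=; rewrite /u; case: asboolP; rewrite ?lexx ?ler01.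
    by rewrite lef_pV2 ?posrE ?weight_gt0// ltW.
  rewrite mul0r (@energy0_const _ _ _ _ _ _ hfin hL _ 0) ?mulr0// => p Vp /=.
  rewrite /u; case: asboolP => // xp; exfalso; move/negP: mz; apply.
  have zp : cell S K z (word_map S z p) by apply: word_map_V0_cell; exists p.
  have [xz|xz] := eqVneq x z.
    have [i _ vi] : range v p by rewrite -VE.
    by apply/existsP; exists i; apply/asboolP; rewrite vi xz.
  have [q + qE] := cell_level_meet hN hS hK hinj hs nx nz xz xp zp.
  rewrite VE => -[i _ vi]; apply/existsP; exists i; apply/asboolP.
  by rewrite vi qE.
rewrite /En sumE big_seq; apply: le_trans (ler_sum _ term) _.
rewrite -big_seq -mulr_suml -mulrA ler_wpM2r ?mulr_ge0 ?invr_ge0 ?(ltW b0)//.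
rewrite -natr_sum ler_nat.
apply: leq_trans (_ : \sum_(z <- ls) \sum_(i < k) (P i z : nat) <= _)%N.
  apply: leq_sum => z _; case: (boolP (meets z)) => // /existsP[i Pi].
  by rewrite (bigD1 i)//= Pi.
rewrite exchange_big/= -[X in (_ <= X * _)%N]card_ord -sum_nat_const.
apply: leq_sum => i _.
rewrite (_ : (\sum_(z <- ls) P i z)%N = size [seq z <- ls | P i z]); last first.
  by rewrite size_filter -sum1_count [RHS]big_mkcond; apply: eq_bigr => z _; case: (P i z).
apply: (hB _ (word_map S x (v i))); first exact: filter_uniq.
  move=> z z'; rewrite !mem_filter => /andP[_ /lsn nz] /andP[_ /lsn nz'].
  exact: level_incomparable nz nz'.
by move=> z; rewrite mem_filter => /andP[/asboolP].
Qed.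

(* The boundary values 1 on [cell x] and 0 elsewhere on Vn are extended
   harmonically; overwriting the extension by the constants on the two cells
   does not increase the energy, since cells meet only in boundary points. *)
Lemma separating_function : exists2 A, 0 < A & forall n x y,
  level s n x -> level s n y -> cell S K x `&` cell S K y = set0 ->
  exists u : M -> R, [/\ {within K, continuous u}, forall p, cell S K x p -> u p = 1,
    forall p, cell S K y p -> u p = 0 &
    (energy S K s H u <= (A * (s_min s ^+ n)^-1)%:E)%E].
Proof.
have [A A0 hA] := cell_indicator_energy.
have b0 := s_min_gt0 hs; have bn0 n : 0 < s_min s ^+ n by rewrite exprn_gt0.
(* The division turns the exponent [n.+1] of [cell_indicator_energy] into [n]; the summand 1 makes
   the constant positive. *)
exists (A / s_min s + 1); first by rewrite ltr_wpDl// divr_ge0// ltW.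
move=> n x y nx ny xy0.
set E := (A / s_min s + 1) * (s_min s ^+ n)^-1.
have := hA n x nx; set u0 := (fun p => _) => hu0.
have u0E : En n u0 <= E.
  apply: le_trans hu0 _; rewrite exprS invfM mulrA /E ler_wpM2r ?invr_ge0 ?(ltW (bn0 _))//.
  by rewrite lerDl.
have [w [wu0 wE]] := harmonic_extension n u0.
have [p xp|p yp|w' [w'x w'y w'E]] := replace_on_cells nx ny xy0 (w := w).
- rewrite wu0; last by exists x.
  by rewrite /u0 asboolT//; exact: word_map_V0_cell.
- rewrite wu0; last by exists y.
  rewrite /u0 asboolF// => xp; have : set0 p by rewrite -xy0; split=> //; exact: word_map_V0_cell.
  by [].
have hw' m : En m w' <= E.
  have [nm|/ltnW mn] := leqP n m; first exact: le_trans (w'E m nm) (le_trans (wE m) u0E).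
  apply: le_trans (energy_n_le w' mn) _.
  exact: le_trans (w'E n (leqnn n)) (le_trans (wE n) u0E).
have [C C0 hC] := finite_energy_extension.
have [u [cu uw' hu]] := hC w' E hw'; set q := Num.sqrt E in hu.
have q0 : 0 <= q by exact: sqrtr_ge0.
(* The extension is tied to [w'] only on the sets [Vn]; it takes the constant value on the whole
   cell because the base points of all subcells have it. *)
have const z c p : level s n z -> (forall t, cell S K z t -> w' t = c) ->
    cell S K z p -> u p = c.
  move=> nz zc zp; apply: (@eq_of_geometric_bound _ _ _ (C * q) r n).
  - by rewrite mulr_ge0.
  - by rewrite ltW.
  move=> m nm; have [t [mt zt] tp] := cell_level_below hN hS hK hs nz nm zp.
  have := hu m t p mt tp; rewrite zc; last exact: (cell_prefix hK zt (base_cell t)).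
  by rewrite mulrAC.
exists u; split=> //.
- by move=> p; apply: const.
- by move=> p; apply: const.
apply: energy_lim_le => m; rewrite (_ : En m u = En m w')//.
by apply: energy_n_eq => p mp; exact: uw' mp.
Qed.

End Morrey.

(** * Walks in the graph and Gromov products *)

Lemma inf_minimum (R : realType) (A : set R) m : A m -> lbound A m -> inf A = m.
Proof.
move=> Am lm; apply/eqP; rewrite eq_le; apply/andP; split.
  by apply: ge_inf => //; exists m.
by apply: lb_le_inf => //; exists m.
Qed.

Section Graph.
Context (R : realType) (N : nat) (M : metricType R).
Context (S : 'I_N -> M -> M) (K : set M) (s : 'I_N -> R).

Definition walk (n : nat) (x y : seq 'I_N) : Prop :=
  exists c : nat -> seq 'I_N,
    [/\ c 0%N = x, c n = y & forall i, (i < n)%N -> edge S K s (c i) (c i.+1)].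

Lemma edge_sym x y : edge S K s x y -> edge S K s y x.
Proof.
case=> [xy|yx|[n [n1 nx ny] [xy [p [xp yp]]]]]; [exact: Or32|exact: Or31|].
by apply: Or33; exists n => //; rewrite eq_sym; split=> //; exists p.
Qed.

Lemma walk_refl x : walk 0 x x.
Proof. by exists (fun=> x). Qed.

Lemma walk_edge x y : edge S K s x y -> walk 1 x y.
Proof. by move=> xy; exists (fun i => if i is 0 then x else y); split=> // -[]. Qed.

Lemma walk_cat m n x y z : walk m x y -> walk n y z -> walk (m + n) x z.
Proof.
move=> [c [c0 cm ce]] [d [d0 dn de]].
exists (fun i => if (i <= m)%N then c i else d (i - m)%N); split=> //.
  have [h|h] := leqP (m + n) m; last by rewrite addKn.
  have n0 : n = 0%N by lia.
  by rewrite n0 addn0 cm -d0 -dn n0.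
move=> i imn; have [im|im|im] := ltngtP i m.
- exact: ce.
- rewrite subSn; last exact: ltnW.
  by apply: de; lia.
by rewrite im subSnn cm -d0; apply: de; lia.
Qed.

Lemma walk_sym n x y : walk n x y -> walk n y x.
Proof.
move=> [c [c0 cn ce]]; exists (fun i => c (n - i)%N); split; rewrite ?subn0 ?subnn//.
move=> i ni; apply: edge_sym; rewrite (_ : (n - i)%N = (n - i.+1).+1); last by lia.
by apply: ce; lia.
Qed.

Lemma walk_split m n x y : walk (m + n) x y -> exists2 z, walk m x z & walk n z y.
Proof.
move=> [c [c0 cn ce]]; exists (c m).
  by exists c; split=> // i im; apply: ce; lia.
exists (fun i => c (m + i)%N); split; rewrite ?addn0// => i ni.
by rewrite addnS; apply: ce; lia.
Qed.

(** Lengths are natural numbers, so the infimum is attained as soon as some walk exists. *)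
Lemma graph_dist_walk n x y : walk n x y ->
  exists2 m, walk m x y & graph_dist S K s x y = m%:R /\ forall k, walk k x y -> (m <= k)%N.
Proof.
move=> xy; have ex : exists n, `[< walk n x y >] by exists n; apply/asboolP.
case: (ex_minnP ex) => m /asboolP mxy mmin; exists m => //; split=> [|k kxy].
  apply: inf_minimum; first by exists m.
  by move=> _ [k kxy <-]; rewrite ler_nat mmin//; apply/asboolP.
by apply: mmin; apply/asboolP.
Qed.

Lemma graph_dist_le n x y : walk n x y -> graph_dist S K s x y <= n%:R.
Proof. by move=> xy; have [m _ [-> h]] := graph_dist_walk xy; rewrite ler_nat h. Qed.

Lemma graph_dist_sym x y : graph_dist S K s x y = graph_dist S K s y x.
Proof.
rewrite /graph_dist; congr (inf [set n%:R | n in _]).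
by apply/seteqP; split=> n; exact: walk_sym.
Qed.

Lemma gromov_prod_sym x y : gromov_prod S K s x y = gromov_prod S K s y x.
Proof. by rewrite /gromov_prod (graph_dist_sym x y) (addrC (graph_dist _ _ _ _ x)). Qed.

Context (hN : (2 <= N)%N) (hK : attractor S K) (hs : forall j, 0 < s j < 1).

Lemma edge_level i x y : level s i x -> edge S K s x y ->
  exists2 j, level s j y & (i <= j.+1)%N && (j <= i.+1)%N.
Proof.
move=> ix [[n [nx ny] _]|[n [nx ny] _]|[n [_ nx ny] _]].
- by exists n.+1; rewrite // (level_uniq hN hs ix nx); lia.
- by exists n; rewrite // (level_uniq hN hs ix ny); lia.
- by exists n; rewrite // (level_uniq hN hs ix nx); lia.
Qed.

Lemma edge_meet x y : edge S K s x y -> cell S K x `&` cell S K y !=set0.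
Proof.
have sub u v : prefix u v -> cell S K u `&` cell S K v !=set0.
  move=> uv; have [p vp] := cell_nonempty hK v.
  by exists p; split=> //; exact: cell_prefix uv _ vp.
by move=> [[n _ /sub]|[n _ /sub]|[n _ []]] //; rewrite setIC.
Qed.

Lemma walk_level n i x y : level s i x -> walk n x y ->
  exists2 j, level s j y & (i <= j + n)%N && (j <= i + n)%N.
Proof.
elim: n y => [|n IH] y ix.
  by move=> [c [c0 cy _]]; exists i; rewrite ?addn0 ?leqnn// -cy c0.
rewrite -addn1 => /walk_split[z /(IH _ ix)[j jz ij] [c [c0 c1 /(_ 0%N isT)]]].
rewrite c0 c1 => /(edge_level jz)[l ly jl]; exists l => //; lia.
Qed.

Lemma walk_vertical m k x y : level s m x -> level s (m + k) y -> prefix x y -> walk k x y.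
Proof.
elim: k m x => [|k IH] m x mx my xy.
  rewrite addn0 in my; rewrite (level_prefix_eq hN hs my mx (leqnn m) xy).
  exact: walk_refl.
have [|z mz zy] := level_ancestor_le hN hs (m := m.+1) my; first by rewrite addnS ltnS leq_addr.
apply: (@walk_cat 1 k x z).
  apply/walk_edge/Or31; exists m => //.
  exact: (level_prefix_le hN hs mx mz (leqnSn m) xy zy).
by apply: (IH m.+1) => //; rewrite addSnnS.
Qed.

Lemma level0 : level s 0 [::]. Proof. by []. Qed.

Lemma walk_root n x : level s n x -> walk n [::] x.
Proof. by move=> nx; apply: (@walk_vertical 0 n) => //; exact: prefix0s. Qed.

Lemma walk_exists m n x y : level s m x -> level s n y -> walk (m + n) x y.
Proof. by move=> /walk_root/walk_sym mx /walk_root ny; exact: walk_cat mx ny. Qed.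

Lemma graph_dist_root n x : level s n x -> graph_dist S K s [::] x = n%:R.
Proof.
move=> nx; have [m mx [-> h]] := graph_dist_walk (walk_root nx).
apply/eqP; rewrite eqr_nat eqn_leq h; last exact: walk_root.
have [j jx] := walk_level level0 mx; rewrite (level_uniq hN hs jx nx); lia.
Qed.

Lemma gromov_prod_ge i j n x y : level s i x -> level s j y -> walk n x y ->
  (i%:R + j%:R - n%:R) / 2 <= gromov_prod S K s x y.
Proof.
move=> ix jy /graph_dist_le h; rewrite /gromov_prod (graph_dist_root ix) (graph_dist_root jy).
lra.
Qed.

Lemma gromov_prod_le_level i j x y : level s i x -> level s j y ->
  gromov_prod S K s x y <= j%:R.
Proof.
move=> ix jy; have [n xy [dE _]] := graph_dist_walk (walk_exists ix jy).
rewrite /gromov_prod (graph_dist_root ix) (graph_dist_root jy) dE.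
have [j' jy' h] := walk_level ix xy.
rewrite (level_uniq hN hs jy' jy) in h.
have : (i%:R : R) <= j%:R + n%:R by rewrite -natrD ler_nat; lia.
lra.
Qed.

(** Climbing to level [m], crossing at most one horizontal edge and descending takes at most
    [2 * (i - m) + 1] steps, so the product is at least [m - 1/2]. *)
Lemma gromov_prod_ray_meet x y m i : ray s x -> ray s y -> (m <= i)%N ->
  cell S K (x m) `&` cell S K (y m) !=set0 ->
  m%:R - 1 <= gromov_prod S K s (x i) (y i).
Proof.
move=> rx ry mi meet.
have vert z : ray s z -> walk (i - m) (z m) (z i).
  move=> rz; apply: (@walk_vertical m).
  - by have [] := rz m.
  - by rewrite subnKC//; have [] := rz i.
  - exact: (ray_mono rz mi).
have [mx _] := rx m; have [my _] := ry m; have [ix _] := rx i; have [iy _] := ry i.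
have [k k1 mid] : exists2 k, (k <= 1)%N & walk k (x m) (y m).
  have [<-|xy] := eqVneq (x m) (y m); first by exists 0%N => //; exact: walk_refl.
  exists 1%N => //; apply/walk_edge/Or33; exists m => //; split=> //.
  (* Horizontal edges exist only from level 1 on; at level 0 both words are empty. *)
  by case: m mx my {vert mi meet} xy => //= -> ->; rewrite eqxx.
have := gromov_prod_ge ix iy (walk_cat (walk_cat (walk_sym (vert _ rx)) mid) (vert _ ry)).
apply: le_trans; rewrite !natrD natrB//.
have : (k%:R : R) <= 1 by rewrite (ler_nat _ k 1).
lra.
Qed.

(* A walk loses at most one level per step, so the oscillations of [u] along it
   form a geometric series dominated by the last term. *)
Lemma walk_osc (u : M -> R) C r : 0 <= C -> 0 < r < 1 ->
  (forall n x p q, level s n x -> cell S K x p -> cell S K x q -> `|u p - u q| <= C * r ^+ n) ->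
  forall k i x y p q, walk k x y -> level s i x -> (k <= i)%N ->
    cell S K x p -> cell S K y q -> `|u p - u q| <= C / (1 - r) * r ^+ (i - k).
Proof.
move=> C0 /andP[r0 r1] osc; have r1' : 0 < 1 - r by rewrite subr_gt0.
elim=> [|k IH] i x y p q xy ix ki xp yq.
  move: xy => [c [c0 c0' _]]; rewrite subn0; rewrite -c0' c0 in yq.
  apply: le_trans (osc _ _ _ _ ix xp yq) _.
  rewrite ler_wpM2r ?exprn_ge0 ?(ltW r0)// ler_pdivlMr//.
  by rewrite ler_piMr//; lra.
rewrite -addn1 in xy; have [z xz [c [c0 c1 /(_ 0%N isT)]]] := walk_split xy.
rewrite c0 c1 => /edge_meet[t [zt yt]].
have [j jy /andP[ij _]] := walk_level ix xy.
rewrite -(subrKA (u t)); apply: le_trans (ler_normD _ _) _.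
have h1 := IH _ _ _ _ _ xz ix (ltnW ki) xp zt.
have h2 : `|u t - u q| <= C * r ^+ (i - k.+1).
  apply: le_trans (osc _ _ _ _ jy yt yq) _; rewrite ler_wpM2l//.
  by rewrite ler_wiXn2l ?ltW//; lia.
apply: le_trans (lerD h1 h2) _.
rewrite (_ : (i - k)%N = (i - k.+1).+1); last by lia.
rewrite exprS mulrA -mulrDl ler_wpM2r ?exprn_ge0 ?(ltW r0)//.
by rewrite le_eqVlt; apply/orP; left; apply/eqP; field; rewrite gt_eqF.
Qed.

(* Both halves of a geodesic from [x] to [y] are walks as in [walk_osc]; the
   midpoint has level at least the Gromov product, up to rounding. *)
Lemma gromov_osc (u : M -> R) C r : 0 <= C -> 0 < r < 1 ->
  (forall n x p q, level s n x -> cell S K x p -> cell S K x q -> `|u p - u q| <= C * r ^+ n) ->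
  forall i x y p q, level s i x -> level s i y -> cell S K x p -> cell S K y q ->
  exists2 k : nat, gromov_prod S K s x y - 1 <= k%:R &
    `|u p - u q| <= 2 * (C / (1 - r)) * r ^+ k.
Proof.
move=> C0 r01 osc i x y p q ix iy xp yq; case/andP: (r01) => r0 r1.
have [n xy [dE dmin]] := graph_dist_walk (walk_exists ix iy).
have n2i : (n <= i + i)%N by apply: dmin; exact: walk_exists.
(* For two vertices of level [i] at distance [n] the Gromov product is [i - n / 2]; [uphalf] rounds
   it down to an integer. *)
exists (i - uphalf n)%N.
  rewrite /gromov_prod (graph_dist_root ix) (graph_dist_root iy) dE natrB; last by lia.
  have : (uphalf n)%:R * 2 <= n%:R + 1 :> R by rewrite -natrM natr1 ler_nat; lia.
  lra.
have nE : n = (n./2 + uphalf n)%N by lia.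
rewrite nE in xy; have [z xz zy] := walk_split xy.
have [t zt] := cell_nonempty hK z.
rewrite -(subrKA (u t)); apply: le_trans (ler_normD _ _) _.
have A0 : 0 <= C / (1 - r) by rewrite divr_ge0//; lra.
have h1 : `|u p - u t| <= C / (1 - r) * r ^+ (i - uphalf n).
  apply: le_trans (walk_osc C0 r01 osc xz ix _ xp zt) _; first by lia.
  by rewrite ler_wpM2l// ler_wiXn2l ?ltW//; lia.
have h2 : `|u t - u q| <= C / (1 - r) * r ^+ (i - uphalf n).
  rewrite distrC; apply: (walk_osc C0 r01 osc (walk_sym zy) iy _ yq zt); lia.
lra.
Qed.

End Graph.

(** * Quasi-metrics and completions *)

(* Frink's argument: split the chain at the link where the partial sums pass
   one half of the total; induction bounds both outer pieces, and [k ^+ 2 <= 2]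
   absorbs the two applications of the quasi-triangle inequality. *)
Lemma quasi_metric_chain (R : realType) (T : Type) (X : set T) (rho : T -> T -> R) k :
  1 <= k -> k ^+ 2 <= 2 -> (forall x y, 0 < rho x y) ->
  (forall x y z, X x -> X y -> X z -> rho x y <= k * Num.max (rho x z) (rho z y)) ->
  forall n (c : nat -> T), (0 < n)%N -> (forall i, (i <= n)%N -> X (c i)) ->
    rho (c 0%N) (c n) <= 2 * \sum_(0 <= i < n) rho (c i) (c i.+1).
Proof.
move=> k1 k2 rho0 qm n; elim: {n}n.+1 {-2}n (ltnSn n) => // m IH n nm c n0 Xc.
pose f i := rho (c i) (c i.+1); pose t j := \sum_(0 <= i < j) f i.
have tS j : t j.+1 = t j + f j by rewrite /t big_nat_recr.
have t_ge0 j : 0 <= t j by apply: sumr_ge0 => i _; rewrite /f ltW.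
have tn0 : 0 < t n.
  by case: n n0 {nm Xc} => // n' _; rewrite tS ltr_wpDl ?t_ge0 ?rho0.
rewrite -/(t n); set L := t n in tn0 *.
have exP : exists p, (p <= n)%N && (t p <= L / 2).
  by exists 0%N; rewrite /= /t big_nil; lra.
have ubP i : (i <= n)%N && (t i <= L / 2) -> (i <= n)%N by case/andP.
(* By the choice of [p] the sums before and after the link [p] are both at most [L / 2], so
   induction bounds each outer piece by [L]; the link itself is at most [L]. *)
case: (ex_maxnP exP ubP) => p /andP[pn tp] pmax.
have {}pn : (p < n)%N.
  rewrite ltn_neqAle pn andbT; apply/eqP => pE; move: tp; rewrite pE -/L; lra.
have [X0 Xp Xp1 Xn] := And4 (Xc _ (leq0n n)) (Xc _ (ltnW pn)) (Xc _ pn) (Xc _ (leqnn n)).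
have tp1 : L / 2 < t p.+1.
  by rewrite ltNge; apply/negP => h; have := pmax p.+1; rewrite pn h /=; lia.
have tailE : \sum_(0 <= i < n - p.+1) rho (c (p.+1 + i)%N) (c (p.+1 + i).+1) = L - t p.+1.
  rewrite /L /t (big_cat_nat (leq0n p.+1) pn)/= [X in X - _]addrC addrK.
  transitivity (\sum_(0 + p.+1 <= i < n) f i); last by rewrite add0n.
  rewrite big_addn; apply: eq_big_nat => i _.
  by rewrite /f addnC.
have mid : f p <= L.
  have -> : L = t p.+1 + (L - t p.+1) by ring.
  rewrite tS; have := t_ge0 p; have : 0 <= L - t p.+1.
    by rewrite -tailE sumr_ge0// => i _; exact: ltW.
  rewrite tS; lra.
have head : (0 < p)%N -> rho (c 0%N) (c p) <= L.
  move=> p0; apply: le_trans (IH p _ c p0 _) _; first by lia.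
    by move=> i ip; apply: Xc; lia.
  rewrite -/(t p); lra.
have tail : (p.+1 < n)%N -> rho (c p.+1) (c n) <= L.
  move=> p1n; have := IH (n - p.+1)%N _ (fun i => c (p.+1 + i)%N); rewrite addn0 subnKC//.
  move=> /(_ _ _ _)/le_trans; apply; [by lia|by lia|by move=> i ip; apply: Xc; lia|].
  under eq_bigr do rewrite addnS.
  rewrite tailE; lra.
have k0 : 0 < k by lra.
have kL : k * L <= 2 * L.
  rewrite ler_wpM2r ?(ltW tn0)//; apply: le_trans k2.
  by rewrite expr2 ler_peMr ?(ltW k0).
have rest : rho (c p) (c n) <= k * L.
  have [p1n|np1] := ltnP p.+1 n.
    apply: le_trans (qm _ _ _ Xp Xn Xp1) _.
    by rewrite ler_wpM2l ?(ltW k0)// ge_max mid tail.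
  have -> : n = p.+1 by apply/eqP; rewrite eqn_leq np1 pn.
  apply: le_trans mid _; rewrite ler_peMl ?(ltW tn0)//.
have [p0|] := posnP p; first by move: rest; rewrite p0 => /le_trans; apply.
move=> /head hp; apply: le_trans (qm _ _ _ X0 Xn Xp) _.
apply: le_trans (_ : k * (k * L) <= _).
  rewrite ler_wpM2l ?(ltW k0)// ge_max rest andbT.
  by apply: le_trans hp _; rewrite ler_peMl ?(ltW tn0)//.
by rewrite mulrA -expr2 ler_wpM2r ?(ltW tn0).
Qed.

Lemma real_cauchy_cvg (R : realType) (u : nat -> R) :
  (forall e, 0 < e -> exists k, forall m n, (k <= m)%N -> (k <= n)%N -> `|u m - u n| < e) ->
  cvgn u.
Proof.
move=> h; apply/cauchy_cvgP/cauchy_exP => e e0; have [k hk] := h e e0.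
exists (u k); exists k => // n /= kn; exact: hk.
Qed.

Lemma cvg_of_dist_le (R : realType) (u v e : nat -> R) (l : R) :
  (forall n, `|u n - v n| <= e n) -> e @ \oo --> (0 : R) -> v @ \oo --> l -> u @ \oo --> l.
Proof.
move=> h e0 vl; have e0' := e0; apply: cvg_sub0 vl.
apply: (@squeeze_cvgr _ _ _ _ (fun n => - e n) e) e0.
  by apply: nearW => n; have := h n; rewrite ler_norml.
by rewrite -[X in _ --> X]oppr0; exact: cvgN e0'.
Qed.

Section CompletionTheory.
Context (R : realType) (T : pointedType) (X : set T) (d : T -> T -> R).
Context (dxx : forall x, d x x = 0) (d_sym : forall x y, d x y = d y x).
Context (d_ge0 : forall x y, 0 <= d x y).
Context (d_tri : forall x y z, X x -> X y -> X z -> d x z <= d x y + d y z).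

Lemma dist_quad x y z t : X x -> X y -> X z -> X t -> `|d x y - d z t| <= d x z + d y t.
Proof.
move=> Xx Xy Xz Xt; rewrite ler_norml.
have := d_tri Xx Xz Xy; have := d_tri Xz Xt Xy.
have := d_tri Xz Xx Xt; have := d_tri Xx Xy Xt.
rewrite (d_sym z x) (d_sym t y) => *; apply/andP; split; lra.
Qed.

Lemma cauchy_dist_cvg u v : cauchy_seqs X d u -> cauchy_seqs X d v ->
  cvgn (fun n => d (u n) (v n)).
Proof.
move=> [Xu cu] [Xv cv]; apply: real_cauchy_cvg => e e0.
have e2 : 0 < e / 2 by lra.
have [k1 h1] := cu _ e2; have [k2 h2] := cv _ e2.
exists (maxn k1 k2) => m n; rewrite !geq_max => /andP[m1 m2] /andP[n1 n2].
apply: le_lt_trans (dist_quad _ _ _ _) _ => //.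
have := h1 m n m1 n1; have := h2 m n m2 n2; lra.
Qed.

Lemma cauchy_class_refl u : cauchy_seqs X d u -> cauchy_class X d u u.
Proof. by move=> cu; split=> //; under eq_cvg do rewrite dxx; exact: cvg_cst. Qed.

(** [completion_dist] uses the representatives picked by [get]; equivalent sequences approach each
    other, so the quadrilateral inequality gives the same limit for any other representatives. *)
Lemma completion_dist_cvg u v : cauchy_seqs X d u -> cauchy_seqs X d v ->
  d (u n) (v n) @[n --> \oo] --> completion_dist d (cauchy_class X d u) (cauchy_class X d v).
Proof.
move=> cu cv.
pose u' := get (cauchy_class X d u); pose v' := get (cauchy_class X d v).
have [cu' uu'] : cauchy_class X d u u'.
  by apply: getPex; exists u; exact: cauchy_class_refl.
have [cv' vv'] : cauchy_class X d v v'.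
  by apply: getPex; exists v; exact: cauchy_class_refl.
have lim' := cauchy_dist_cvg cu' cv'.
have e0 : (fun n => d (u n) (u' n) + d (v n) (v' n)) @ \oo --> (0 : R).
  by rewrite -(addr0 0); exact: cvgD.
apply: (@cvg_of_dist_le _ _ (fun n => d (u' n) (v' n)) _ _ _ e0 lim') => n.
by apply: dist_quad; case: cu => + _; case: cv => + _; case: cu' => + _; case: cv'.
Qed.

Lemma const_cauchy x : X x -> cauchy_seqs X d (fun=> x).
Proof. by move=> Xx; split=> // e e0; exists 0%N => *; rewrite dxx. Qed.

Lemma converges_dist x y z z' : (forall i, X (x i)) -> (forall i, X (y i)) ->
  completion X d z -> completion X d z' ->
  converges_to X d x z -> converges_to X d y z' ->
  d (x i) (y i) @[i --> \oo] --> completion_dist d z z'.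
Proof.
move=> Xx Xy [u cu <-] [v cv <-] xu yv.
pose e i := completion_dist d (embed X d (x i)) (cauchy_class X d u) +
            completion_dist d (embed X d (y i)) (cauchy_class X d v).
apply: (@cvg_of_dist_le _ _ (fun=> completion_dist d (cauchy_class X d u) (cauchy_class X d v)) e).
- move=> i.
  have h := completion_dist_cvg cu cv.
  have hx := completion_dist_cvg (const_cauchy (Xx i)) cu.
  have hy := completion_dist_cvg (const_cauchy (Xy i)) cv.
  have hl : `|d (x i) (y i) - d (u n) (v n)| @[n --> \oo] -->
      `|d (x i) (y i) - completion_dist d (cauchy_class X d u) (cauchy_class X d v)|.
    by apply: cvg_norm; apply: cvgB h; exact: cvg_cst.
  apply: ler_cvg_to hl (cvgD hx hy) _; apply: nearW => n.
  by apply: dist_quad => //; [case: cu|case: cv].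
- by rewrite -(addr0 0); exact: cvgD xu yv.
- exact: cvg_cst.
Qed.

Lemma ray_completion x (e : nat -> R) : (forall i, X (x i)) -> e @ \oo --> (0 : R) ->
  (forall i j, (i <= j)%N -> d (x i) (x j) <= e i) ->
  cauchy_seqs X d x /\ converges_to X d x (cauchy_class X d x).
Proof.
move=> Xx e0 xe.
have cx : cauchy_seqs X d x.
  split=> // f f0; have [k _ hk] := cvgr0_norm_lt _ e0 _ f0; exists k.
  move=> m n km kn; wlog mn : m n km kn / (m <= n)%N.
    by move=> h; have [|/ltnW] := leqP m n; [|rewrite d_sym]; exact: h.
  apply: le_lt_trans (xe _ _ mn) _; apply: le_lt_trans (ler_norm _) _; exact: hk.
split=> //.
apply: (@squeeze_cvgr _ _ _ _ (fun=> 0) e) e0; last exact: cvg_cst.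
apply: nearW => i; have h := completion_dist_cvg (const_cauchy (Xx i)) cx.
apply/andP; split.
  by apply: ler_cvg_to (cvg_cst _) h _; apply: nearW => n.
by apply: ler_cvg_to h (cvg_cst _) _; exists i => // n /=; exact: xe.
Qed.

(** Convergence to [y] would bring the sequence within [c] of [y], which only terms equal to [y] can
    be; this is how limits of rays are kept out of the embedded vertex set. *)
Lemma boundary_class x c y : cauchy_seqs X d x -> 0 < c -> X y ->
  (forall i, x i != y -> c <= d (x i) y) -> (forall n, exists2 i, (n <= i)%N & x i != y) ->
  cauchy_class X d x <> embed X d y.
Proof.
move=> cx c0 Xy xc inf e; have := cauchy_class_refl cx; rewrite e => -[_].
move=> /cvgr0_norm_lt/(_ _ c0)[k _ hk]; have [i ki xi] := inf k.
have := hk i ki; rewrite /= ger0_norm// d_sym ltNge => /negP; apply; exact: xc.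
Qed.

End CompletionTheory.

(** * Visual metric and resistance metric *)

Section Visual.
Context (R : realType) (N : nat) (M : metricType R).
Context (S : 'I_N -> M -> M) (K : set M) (s : 'I_N -> R) (a : R).
Let X : set (seq 'I_N) := vertices s.
Let rho x y := expR (- a * gromov_prod S K s x y).

Definition chain_sums (x y : seq 'I_N) : set R :=
  [set t | exists (n : nat) (c : nat -> seq 'I_N),
    [/\ (1 <= n)%N, c 0%N = x, c n = y, forall i, (i <= n)%N -> X (c i) &
        t = \sum_(i < n) rho (c i) (c i.+1)]].

Lemma thetaE x y : x != y -> theta S K s a x y = inf (chain_sums x y).
Proof. by move=> /negbTE xy; rewrite /theta xy. Qed.

Lemma thetaxx x : theta S K s a x x = 0.
Proof. by rewrite /theta eqxx. Qed.

Lemma chain_sums_ge0 x y : lbound (chain_sums x y) 0.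
Proof. by move=> _ [n [c [_ _ _ _ ->]]]; apply: sumr_ge0 => i _; exact: expR_ge0. Qed.

Lemma chain_sums_edge x y : X x -> X y -> chain_sums x y (rho x y).
Proof.
move=> Xx Xy; exists 1%N, (fun i => if i is 0 then x else y); split=> //.
  by case.
by rewrite big_ord1.
Qed.

Lemma chain_sums_inf x y t : chain_sums x y t -> inf (chain_sums x y) <= t.
Proof. by apply: ge_inf; exists 0; exact: chain_sums_ge0. Qed.

Lemma theta_ge0 x y : 0 <= theta S K s a x y.
Proof.
have [->|xy] := eqVneq x y; first by rewrite thetaxx.
rewrite thetaE//; have [->|/set0P ne] := eqVneq (chain_sums x y) set0; first by rewrite inf0.
by apply: lb_le_inf => //; exact: chain_sums_ge0.
Qed.

Lemma chain_sums_sym x y : chain_sums x y `<=` chain_sums y x.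
Proof.
move=> _ [n [c [n1 c0 cn Xc ->]]]; exists n, (fun i => c (n - i)%N).
split; rewrite ?subn0 ?subnn//; first by move=> i _; apply: Xc; exact: leq_subr.
rewrite (reindex_inj rev_ord_inj)/=; apply: eq_bigr => i _.
have rhoS u v : rho u v = rho v u by rewrite /rho gromov_prod_sym.
by rewrite [LHS]rhoS subnSK.
Qed.

Lemma theta_sym x y : theta S K s a x y = theta S K s a y x.
Proof.
have [->//|xy] := eqVneq x y; rewrite !thetaE// 1?eq_sym//.
by congr inf; apply/seteqP; split; exact: chain_sums_sym.
Qed.

Lemma chain_sums_cat x y z t t' : chain_sums x y t -> chain_sums y z t' ->
  chain_sums x z (t + t').
Proof.
move=> [m [c [m1 c0 cm Xc ->]]] [n [d [n1 d0 dn Xd ->]]].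
pose f i := if (i <= m)%N then c i else d (i - m)%N.
have fd i : f (m + i)%N = d i.
  rewrite /f; case: i => [|i]; first by rewrite addn0 leqnn cm.
  by rewrite ifF ?addKn//; lia.
exists (m + n)%N, f; split=> //.
- lia.
- by rewrite fd.
- move=> i imn; rewrite /f; case: leqP => im; first exact: Xc.
  by apply: Xd; lia.
rewrite big_split_ord/=; congr (_ + _); apply: eq_bigr => i _.
  by rewrite /f ltn_ord ltnW.
by rewrite -addnS !fd.
Qed.

Lemma theta_triangle x y z : X x -> X y -> X z ->
  theta S K s a x z <= theta S K s a x y + theta S K s a y z.
Proof.
move=> Xx Xy Xz.
have [->|xz] := eqVneq x z; first by rewrite thetaxx addr_ge0// theta_ge0.
have [->|xy] := eqVneq x y; first by rewrite thetaxx add0r.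
have [->|yz] := eqVneq y z; first by rewrite thetaxx addr0.
rewrite !thetaE// -lerBlDr; apply: lb_le_inf; first by exists (rho x y); exact: chain_sums_edge.
move=> t xyt; rewrite lerBlDr -lerBlDl; apply: lb_le_inf.
  by exists (rho y z); exact: chain_sums_edge.
by move=> t' yzt'; rewrite lerBlDl; apply: chain_sums_inf; exact: chain_sums_cat xyt yzt'.
Qed.

Lemma theta_le_exp x y : X x -> X y -> theta S K s a x y <= rho x y.
Proof.
move=> Xx Xy; have [->|xy] := eqVneq x y; first by rewrite thetaxx expR_ge0.
by rewrite thetaE//; apply: chain_sums_inf; exact: chain_sums_edge.
Qed.

Lemma ray_vertex x i : ray s x -> X (x i).
Proof. by move=> rx; exists i => //; have [] := rx i. Qed.

Lemma theta_K_cvg x y p q : ray s x -> ray s y ->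
  converges_to X (theta S K s a) x (kappa_inv S K s a p) ->
  converges_to X (theta S K s a) y (kappa_inv S K s a q) ->
  completion X (theta S K s a) (kappa_inv S K s a p) ->
  completion X (theta S K s a) (kappa_inv S K s a q) ->
  theta S K s a (x i) (y i) @[i --> \oo] --> theta_K S K s a p q.
Proof.
move=> rx ry xp yq cp cq.
apply: (@converges_dist _ _ X (theta S K s a) thetaxx theta_sym theta_triangle) => // i.
  exact: ray_vertex.
exact: ray_vertex.
Qed.

Context (delta : R) (hN : (2 <= N)%N) (hs : forall j, 0 < s j < 1).
Context (hdelta : 0 <= delta) (hhyp : gromov_hyperbolic S K s delta).
Context (ha : 0 < a) (hda : expR (delta * a) < Num.sqrt 2).

(** Exponentiating the hyperbolicity inequality gives the quasi-metric inequality for [rho] with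
    constant e^(delta a), whose square is below 2; so every chain sum is at least half of
    [rho x y]. *)
Lemma theta_ge_exp x y : X x -> X y -> x != y -> rho x y <= 2 * theta S K s a x y.
Proof.
move=> Xx Xy xy; rewrite thetaE// mulrC -ler_pdivrMr//.
apply: lb_le_inf; first by exists (rho x y); exact: chain_sums_edge.
move=> _ [n [c [n1 <- <- Xc ->]]]; rewrite ler_pdivrMr// mulrC.
rewrite -(big_mkord xpredT (fun i => rho (c i) (c i.+1))).
apply: (@quasi_metric_chain _ _ X rho (expR (delta * a))) => //.
- by rewrite -expR0 ler_expR mulr_ge0// ltW.
- rewrite -[leRHS]sqr_sqrtr//.
  by rewrite ler_sqr ?nnegrE ?expR_ge0 ?sqrtr_ge0// ltW.
- by move=> *; exact: expR_gt0.
move=> {xy}u v w Xu Xv Xw.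
have h : expR (delta * a) * rho u w <= expR (delta * a) * Num.max (rho u w) (rho w v).
  by rewrite ler_wpM2l ?expR_ge0// le_max lexx.
have h' : expR (delta * a) * rho w v <= expR (delta * a) * Num.max (rho u w) (rho w v).
  by rewrite ler_wpM2l ?expR_ge0// le_max lexx orbT.
have := hhyp Xu Xv Xw; rewrite lerBlDr ge_min => /orP[g|g].
  apply: le_trans h; rewrite /rho -expRD ler_expR.
  by have := ler_wpM2l (ltW ha) g; lra.
apply: le_trans h'; rewrite /rho -expRD ler_expR.
by have := ler_wpM2l (ltW ha) g; lra.
Qed.

(** A ray is Cauchy since (x_i|x_j) >= i for i <= j. Its limit is no vertex [y], since (x_i|y) is at
    most the level of [y], which keeps x_i away from [y]. *)
Lemma kappa_exists x p : ray s x -> \bigcap_i cell S K (x i) = [set p] ->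
  exists z, kappa S K s a z p.
Proof.
move=> rx xp; exists (cauchy_class X (theta S K s a) x).
have Xx i : X (x i) by exact: ray_vertex.
have [||cx xz] := @ray_completion _ _ X (theta S K s a) thetaxx theta_sym theta_ge0 theta_triangle x
  (fun i => expR (- a) ^+ i) Xx.
- by apply: cvg_expr; rewrite ger0_norm ?expR_ge0// expR_lt1 oppr_lt0.
- move=> i j ij; apply: le_trans (theta_le_exp _ _) _ => //.
  rewrite -expRM_natr ler_expR !mulNr lerN2 ler_wpM2l ?(ltW ha)//.
  have [ix _] := rx i; have [jx _] := rx j.
  have : walk S K s (j - i) (x i) (x j).
    apply: (@walk_vertical _ _ _ S K s hN hs i (j - i)) => //; first by rewrite subnKC.
    exact: (ray_mono rx ij).
  move=> /(gromov_prod_ge hN hs ix jx); rewrite natrB//; apply: le_trans.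
  by rewrite le_eqVlt; apply/orP; left; apply/eqP; field.
split; last by exists x.
split; first by exists x.
move=> [y Xy /esym e]; have [j _ yj] := Xy.
apply: (@boundary_class _ _ X (theta S K s a) thetaxx theta_sym theta_ge0 x
  (expR (- a * j%:R) / 2) y cx _ Xy _ _ e).
- by rewrite divr_gt0// expR_gt0.
- move=> i xy; rewrite ler_pdivrMr// [leRHS]mulrC.
  apply: le_trans (theta_ge_exp (Xx i) Xy xy).
  rewrite ler_expR !mulNr lerN2 ler_wpM2l ?(ltW ha)//.
  by have [ix _] := rx i; exact: gromov_prod_le_level ix yj.
move=> n; exists (n + j.+1)%N; first exact: leq_addr.
apply/eqP => xy; have [ix _] := rx (n + j.+1)%N.
by rewrite xy in ix; have := level_uniq hN hs ix yj; lia.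
Qed.

(** [kappa_inv] is a choice, so the ray obtained may differ from the given one, which only shows
    that there is something to choose. *)
Lemma kappa_inv_ray p : (exists x, ray s x /\ forall n, cell S K (x n) p) ->
  (forall x, ray s x -> (forall n, cell S K (x n) p) -> \bigcap_i cell S K (x i) = [set p]) ->
  exists x, [/\ ray s x, forall n, cell S K (x n) p,
    converges_to X (theta S K s a) x (kappa_inv S K s a p) &
    completion X (theta S K s a) (kappa_inv S K s a p)].
Proof.
move=> [x [rx xp]] h; have kz : kappa S K s a (kappa_inv S K s a p) p.
  exact: (@getPex _ [set z | kappa S K s a z p] (kappa_exists rx (h x rx xp))).
case: kz => -[zc _] [y [ry yz yp]]; exists y; split=> // n.
by have : [set p] p by []; rewrite -yp; exact.
Qed.

End Visual.

Section Resistance.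
Context (R : realType) (N : nat) (M : metricType R).
Context (S : 'I_N -> M -> M) (K : set M) (s : 'I_N -> R) (H : M -> M -> R).
Context (hN : (2 <= N)%N) (hS : contractive S) (hK : attractor S K).
Context (hinj : forall j, set_inj K (S j)) (hconn : connected K).
Context (hpcf : pcf S K) (hs : forall j, 0 < s j < 1).
Context (hirr : irreducible S K H) (hH : regular_harmonic S K s H).

(** The lower bound and the competitor make the infimum finite and positive, so that [fine] and
    inversion are harmless. *)
Lemma resistance_bounds p q (c c' : R) : p != q -> 0 < c ->
  (forall u, energy_domain S K s H u -> u p = 1 -> u q = 0 -> (c%:E <= energy S K s H u)%E) ->
  (exists u, [/\ energy_domain S K s H u, u p = 1, u q = 0 & (energy S K s H u <= c'%:E)%E]) ->
  c'^-1 <= resistance S K s H p q <= c^-1.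
Proof.
move=> pq c0 lb [u [du up uq uc']]; rewrite /resistance (negbTE pq).
set I := ereal_inf _.
have cI : (c%:E <= I)%E by apply: le_ereal_inf_tmp => _ [v [dv vp vq] <-]; exact: lb.
have Ic' : (I <= c'%:E)%E.
  by apply: le_trans uc'; apply: ereal_inf_lbound; exists u.
have If : I \is a fin_num.
  by rewrite fin_numElt (lt_le_trans _ cI) ?ltNyr//= (le_lt_trans Ic')// ltry.
rewrite -(fineK If) !lee_fin in cI Ic'.
have I0 : 0 < fine I by exact: lt_le_trans cI.
by rewrite !lef_pV2 ?posrE ?cI ?Ic'// (lt_le_trans I0).
Qed.

Lemma resistance_gromov : exists c1 c2 : R, [/\ 0 < c1, 0 < c2 & forall x y p q,
  ray s x -> ray s y -> (forall n, cell S K (x n) p) -> (forall n, cell S K (y n) q) ->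
  p != q -> exists n, forall i, (n <= i)%N -> x i != y i /\
    c1 * expR (gromov_prod S K s (x i) (y i) * ln (s_min s)) <= resistance S K s H p q <=
    c2 * expR (gromov_prod S K s (x i) (y i) * ln (s_min s))].
Proof.
have [v0 hv0] := V0_nonempty hN hS hK hinj hconn.
have [C C0 hC] := morrey hN hS hK hinj hconn hpcf hs hirr hH hv0.
have [A A0 hA] := separating_function hN hS hK hinj hconn hpcf hs hirr hH hv0.
set b := s_min s; set r := Num.sqrt b in hC; set l := ln b.
have b0 : 0 < b := s_min_gt0 hs.
have b1 : b < 1 := s_min_lt1 hN hs.
have r01 : 0 < r < 1 := root_s_min hN hs.
have /andP[r0 r1] := r01.
have l0 : l < 0 by apply: ln_lt0; rewrite b0.
have bE n : b ^+ n = expR (n%:R * l) by rewrite expRM_natl lnK.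
(* The square of the constant from [gromov_osc], since energy enters oscillations through its square
   root; the summand 1 gives positivity. *)
pose D := (2 * (C / (1 - r))) ^+ 2 + 1.
have D0 : 0 < D by rewrite ltr_wpDl// sqr_ge0.
(* With g the Gromov product, the factor [expR (2 * l)] comes from [n <= g + 2] for the separation
   level [n], and [expR (- l)] from the rounding [g - 1 <= k] of the geodesic midpoint. *)
exists (A^-1 * expR (2 * l)), (D * expR (- l)); split.
- by rewrite mulr_gt0 ?invr_gt0 ?expR_gt0.
- by rewrite mulr_gt0 ?expR_gt0.
move=> x y p q rx ry xp yq pq.
have [n1 hn1] : exists n, cell S K (x n) `&` cell S K (y n) = set0.
  have d0 : 0 < mdist p q / 2 by rewrite divr_gt0// mdist_gt0.
  have [n hn] := level_cell_small hN hS hK hs d0; exists n.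
  apply/eqP; apply: contraT => /set0P[t [xt yt]].
  have [nx _] := rx n; have [ny _] := ry n.
  have := hn n _ _ _ (leqnn n) nx (xp n) xt; have := hn n _ _ _ (leqnn n) ny yt (yq n).
  have := metric_triangle p t q; lra.
have ex : exists n, `[< cell S K (x n) `&` cell S K (y n) = set0 >].
  by exists n1; apply/asboolP.
case: (ex_minnP ex) => n /asboolP xyn nmin.
have n0 : (0 < n)%N.
  rewrite lt0n; apply/eqP => n0; move: xyn; rewrite n0.
  have [/= -> _] := rx 0%N; have [/= -> _] := ry 0%N.
  by rewrite setIid => e; have [t] := cell_nonempty hK [::]; rewrite e.
have meet : cell S K (x n.-1) `&` cell S K (y n.-1) !=set0.
  apply/set0P/eqP => e; have := nmin n.-1; rewrite asboolT// => /(_ isT); lia.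
exists n => i ni; have [ix _] := rx i; have [iy _] := ry i.
split.
  apply/eqP => xy; have [t xt] := cell_nonempty hK (x i).
  have : set0 t; last by [].
  rewrite -xyn; split; apply: (cell_prefix hK _ xt); last rewrite xy; exact: ray_mono.
set g := gromov_prod S K s (x i) (y i).
have g_ge : n%:R - 2 <= g.
  have := gromov_prod_ray_meet hN hs rx ry (leq_trans (leq_pred n) ni) meet.
  rewrite -[in n%:R](prednK n0) -natr1 -/g; lra.
have -> : A^-1 * expR (2 * l) * expR (g * l) = (A * expR (- ((g + 2) * l)))^-1.
  by rewrite invfM -expRN opprK -mulrA -expRD; congr (_ * expR _); ring.
have -> : D * expR (- l) * expR (g * l) = (D^-1 * expR (- ((g - 1) * l)))^-1.
  by rewrite invfM invrK -expRN opprK -mulrA -expRD; congr (_ * expR _); ring.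
apply: resistance_bounds => //.
- by rewrite mulr_gt0 ?invr_gt0 ?expR_gt0.
- move=> u [cu uoo] up uq; have e0 : (0%:E <= energy S K s H u)%E.
    apply: le_trans (energy_lim_ge hH 0 u).
    by rewrite lee_fin; apply: energy_n_ge0 => //; case: hH.
  have uf : energy S K s H u \is a fin_num by rewrite ge0_fin_numE.
  rewrite -(fineK uf) lee_fin; set E := fine _.
  have hE m : energy_n S K s H m u <= E.
    by have := energy_lim_ge hH m u; rewrite -(fineK uf) lee_fin.
  have E0 : 0 <= E by apply: fine_ge0.
  have osc n' z p' q' : level s n' z -> cell S K z p' -> cell S K z q' ->
      `|u p' - u q'| <= C * Num.sqrt E * r ^+ n'.
    by move=> nz zp zq; rewrite mulrAC; exact: hC cu hE _ _ _ _ nz zp zq.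
  have CE : 0 <= C * Num.sqrt E by rewrite mulr_ge0 ?sqrtr_ge0.
  have [k gk] := gromov_osc hN hK hs CE r01 osc ix iy (xp i) (yq i).
  rewrite up uq subr0 normr1 => h1.
  (* The oscillation bound for a function with values 1 and 0 is squared; [r ^+ 2 = b] turns
     [r ^+ k] into [b ^+ k]. *)
  have h2 : 1 <= D * E * expR ((g - 1) * l).
    have : 1 <= (2 * (C * Num.sqrt E / (1 - r)) * r ^+ k) ^+ 2.
      by rewrite -[leLHS](expr1n _ 2) ler_sqr// nnegrE// (le_trans _ h1).
    move=> /le_trans; apply.
    have -> : (2 * (C * Num.sqrt E / (1 - r)) * r ^+ k) ^+ 2 =
        (2 * (C / (1 - r))) ^+ 2 * E * b ^+ k.
      rewrite -[E in RHS]sqr_sqrtr// -[b]sqr_sqrtr ?(ltW b0)// -/r -exprM mulnC exprM.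
      by ring.
    apply: ler_pM.
    - by rewrite mulr_ge0// sqr_ge0.
    - by rewrite exprn_ge0// ltW.
    - by rewrite ler_wpM2r// lerDl.
    by rewrite bE ler_expR ler_wnM2r// ltW.
  rewrite expRN -invfM -[_^-1]mul1r ler_pdivrMr; last by rewrite mulr_gt0 ?expR_gt0.
  by rewrite mulrCA mulrA.
- have [nx _] := rx n; have [ny _] := ry n.
  have [u [cu ux uy uE]] := hA n _ _ nx ny xyn; exists u; split=> //.
  + by split=> //; apply: le_lt_trans uE _; rewrite ltry.
  + exact: ux.
  + exact: uy.
  apply: le_trans uE _; rewrite lee_fin ler_wpM2l ?(ltW A0)// -/b bE -expRN ler_expR lerN2.
  by rewrite ler_wnM2r ?(ltW l0)//; lra.
Qed.

End Resistance.

Theorem theorem6p7 (R : realType) (M : metricType R) (N : nat)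
    (S : 'I_N -> M -> M) (K : set M) (s : 'I_N -> R) (H : M -> M -> R)
    (delta a : R)
    (hM : is_complete M)
    (hN : (2 <= N)%N)
    (hS : contractive S)
    (hK : attractor S K)
    (hinj : forall j, set_inj K (S j))
    (hconn : connected K)
    (hpcf : pcf S K)
    (hs : forall j, 0 < s j < 1)
    (hirr : irreducible S K H)
    (hH : regular_harmonic S K s H)
    (hdelta : 0 <= delta)
    (hhyp : gromov_hyperbolic S K s delta)
    (ha : 0 < a)
    (hda : expR (delta * a) < Num.sqrt 2) :
  exists C : R, 1 <= C /\
    forall xi eta, K xi -> K eta ->
      C^-1 * resistance S K s H xi eta `^ (- a / ln (s_min s))
        <= theta_K S K s a xi eta
        <= C * resistance S K s H xi eta `^ (- a / ln (s_min s)).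
Proof.
have l0 : ln (s_min s) < 0 by apply: ln_lt0; rewrite s_min_gt0// (s_min_lt1 hN hs).
set l := ln (s_min s) in l0 *; set alpha := - a / l.
have alpha0 : 0 < alpha by rewrite /alpha -mulrNN opprK -invrN divr_gt0// oppr_gt0.
have [c1 [c2 [c10 c20 hR]]] := resistance_gromov hN hS hK hinj hconn hpcf hs hirr hH.
have d10 : 0 < c1 `^ alpha by exact: powR_gt0.
have d20 : 0 < c2 `^ alpha by exact: powR_gt0.
(* The term [2 * c2 ^ alpha] serves the lower bound, with the 2 from the chain lemma; the inverse of
   [c1 ^ alpha] serves the upper bound. *)
pose C := 1 + 2 * c2 `^ alpha + (c1 `^ alpha)^-1.
have i10 : 0 < (c1 `^ alpha)^-1 by rewrite invr_gt0.
have C1 : 1 <= C by rewrite /C; lra.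
exists C; split=> // p q Kp Kq.
have rayK t : K t -> exists x, [/\ ray s x, forall n, cell S K (x n) t,
    converges_to (vertices s) (theta S K s a) x (kappa_inv S K s a t) &
    completion (vertices s) (theta S K s a) (kappa_inv S K s a t)].
  move=> Kt; apply: (kappa_inv_ray hN hs hdelta hhyp ha hda).
    exact: (ray_exists hN hS hK hs Kt).
  by move=> x rx xt; exact: (ray_cells_point hN hS hK hs rx xt).
have [x [rx xp xz cz]] := rayK p Kp; have [y [ry yq yz cz']] := rayK q Kq.
(* On the diagonal all three quantities are 0: the same ray represents both points, and [alpha] is
   nonzero, so the power of 0 is 0. *)
have [<-|pq] := eqVneq p q.
  have := theta_K_cvg rx rx xz xz cz cz.
  rewrite (_ : (fun i => theta S K s a (x i) (x i)) = fun=> 0); last first.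
    by apply/funext => i; rewrite thetaxx.
  move=> /(cvg_unique _ (cvg_cst _)) <- //.
  by rewrite /resistance eqxx powR0 ?mulr0 ?lexx// gt_eqF.
have lim := theta_K_cvg rx ry xz yz cz cz'.
have [n hn] := hR x y p q rx ry xp yq pq.
set r := resistance S K s H p q in hn *.
have bounds i : (n <= i)%N -> C^-1 * r `^ alpha <= theta S K s a (x i) (y i) <= C * r `^ alpha.
  move=> /hn[xy /andP[]]; set g := gromov_prod _ _ _ _ _ => lo hi.
  have Xx := ray_vertex i rx; have Xy := ray_vertex i ry.
  have eg : expR (g * l) `^ alpha = expR (- a * g).
    by rewrite -expRM; congr expR; rewrite /alpha; field; rewrite lt_eqF.
  have r0 : 0 < r by apply: lt_le_trans lo; rewrite mulr_gt0 ?expR_gt0.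
  have lo' : c1 `^ alpha * expR (- a * g) <= r `^ alpha.
    rewrite -eg -powRM ?expR_ge0 ?(ltW c10)//.
    apply: (ge0_ler_powR (ltW alpha0)) lo; rewrite nnegrE ?(ltW r0)//.
    by rewrite mulr_ge0 ?expR_ge0 ?(ltW c10).
  have hi' : r `^ alpha <= c2 `^ alpha * expR (- a * g).
    rewrite -eg -powRM ?expR_ge0 ?(ltW c20)//.
    apply: (ge0_ler_powR (ltW alpha0)) hi; rewrite nnegrE ?(ltW r0)//.
    by rewrite mulr_ge0 ?expR_ge0 ?(ltW c20).
  have up := theta_le_exp S K a Xx Xy.
  have low := theta_ge_exp hdelta hhyp ha hda Xx Xy xy.
  rewrite -/g in up low; apply/andP; split.
    rewrite mulrC ler_pdivrMr; last by rewrite (lt_le_trans _ C1).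
    apply: le_trans hi' _; apply: le_trans (ler_wpM2l (ltW d20) low) _.
    have t0 := theta_ge0 S K s a (x i) (y i).
    rewrite mulrA [leLHS]mulrC ler_wpM2l// /C; lra.
  apply: le_trans up _; apply: le_trans (_ : (c1 `^ alpha)^-1 * r `^ alpha <= _).
    by rewrite ler_pdivlMl.
  by rewrite ler_wpM2r ?powR_ge0// /C; lra.
have [lo hi] : (\forall i \near \oo, C^-1 * r `^ alpha <= theta S K s a (x i) (y i)) /\
    (\forall i \near \oo, theta S K s a (x i) (y i) <= C * r `^ alpha).
  by split; exists n => // i /= /bounds/andP[].
by apply/andP; split; [exact: ler_cvg_to (cvg_cst _) lim lo|exact: ler_cvg_to lim (cvg_cst _) hi].
Qed.
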